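(* For generic $\mathcal L\in\mathrm{Pic}^0(C)$, the rank-$2$ vector bundle $\mathcal E=f_*\mathcal L$ on $E$ is stable.
   Context: Let $t,t'\in\mathbb C\setminus\{0,1\}$, $t\neq t'$. $E$: $y^2=x(x-1)(x-t)$; $C$ is the genus-$2$ curve $y^2=(t'-\xi^2)(t'-1-\xi^2)(t'-t-\xi^2)$ (smooth projective models); $f:C\to E$, $(\xi,y)\mapsto(t'-\xi^2,y)$, of degree $2$. ''Generic'' means: for all $\mathcal L$ in a nonempty Zariski open subset of $\mathrm{Pic}^0(C)$. A rank-$2$ bundle $\mathcal E$ on a curve is stable if $\deg\mathcal M<\frac12\deg\mathcal E$ for every line subbundle $\mathcal M\subset\mathcal E$. *)

(* Defs.v *)
From HB Require Import structures.
From mathcomp Require Import all_boot all_order all_algebra.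
From mathcomp Require Import complex.
From mathcomp Require Import all_classical reals.

Set Implicit Arguments.
Unset Strict Implicit.
Unset Printing Implicit Defensive.

Import Order.TTheory GRing.Theory Num.Theory.

Local Open Scope classical_set_scope.
Local Open Scope ring_scope.

(* Throughout, a smooth projective curve over k is given by its function field
   K, with i : k -> K the inclusion of the constants. *)

(* For F in k[X][Y] (outer variable Y): K is the fraction field of
   k[X, Y] / (F), the classes of X and Y being x and y. *)
Definition function_field_of (k K : fieldType) (i : {rmorphism k -> K})
    (F : {poly {poly k}}) (x y : K) : Prop :=
  let ev (N : {poly {poly k}}) := (map_poly (map_poly i) N).[y%:P].[x] in
  (forall N, ev N = 0 <-> exists G, N = F * G) /\
  (forall z : K, exists N D, ev D != 0 /\ z = ev N / ev D).

(* The closed points of the smooth projective curve with function field K are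
   the normalized discrete valuations of K trivial on k. The value at 0 is a
   dummy, fixed so that distinct points are distinct valuations. *)
Record closed_point (k K : fieldType) (i : {rmorphism k -> K})
    : Type := ClosedPoint {
  valuation :> K -> int;
  valuation0 : valuation 0 = 0;
  valuationM : forall a b, a != 0 -> b != 0 ->
    valuation (a * b) = valuation a + valuation b;
  valuationD : forall a b, a != 0 -> b != 0 -> a + b != 0 ->
    Num.min (valuation a) (valuation b) <= valuation (a + b);
  valuation_const : forall c : k, c != 0 -> valuation (i c) = 0;
  valuation_unif : exists2 a, a != 0 & valuation a = 1
}.

HB.instance Definition _ (k K : fieldType) (i : {rmorphism k -> K}) :=
  gen_eqMixin (closed_point i).
HB.instance Definition _ (k K : fieldType) (i : {rmorphism k -> K}) :=
  gen_choiceMixin (closed_point i).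

Section Curve.
Variables (k K : fieldType) (i : {rmorphism k -> K}).
Implicit Types (P Q : closed_point i) (a b : K).

Definition regular_at P a : Prop := a = 0 \/ 0 <= P a.
Definition vanishes_at P a : Prop := a = 0 \/ 0 < P a.

(* The value a(P) of a function regular at P, k being algebraically closed. *)
Definition value P a : k := xget 0 [set c | vanishes_at P (a - i c)].

(* Zariski topology of the surface C x C: the basic open sets are the loci
   where finitely many functions a_j of the first point and b_j of the second
   are all regular and sum_j a_j(P) b_j(Q) is nonzero. *)
Definition basic_open2 (n : nat) (a b : 'I_n -> K)
    : set (closed_point i * closed_point i) :=
  [set PQ | (forall j, regular_at PQ.1 (a j) /\ regular_at PQ.2 (b j)) /\
            \sum_(j < n) value PQ.1 (a j) * value PQ.2 (b j) != 0].

Definition zariski_open2 (W : set (closed_point i * closed_point i)) : Prop :=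
  forall PQ, W PQ -> exists (n : nat) (a b : 'I_n -> K),
    basic_open2 a b PQ /\ basic_open2 a b `<=` W.

(* A vector bundle with generic fibre inside the K-vector space V is given by
   its stalks E P in V; the sections over an open set U are the v in V lying in
   E P for all P in U. *)
Section Bundles.
Variable V : lmodType K.
Implicit Types (E M : closed_point i -> set V).

Definition independent (n : nat) (e : 'I_n -> V) : Prop :=
  forall c : 'I_n -> K, \sum_(j < n) c j *: e j = 0 -> forall j, c j = 0.

(* The module spanned by e over the local ring of P. *)
Definition local_span (n : nat) P (e : 'I_n -> V) : set V :=
  [set v | exists2 c : 'I_n -> K, (forall j, regular_at P (c j)) &
           v = \sum_(j < n) c j *: e j].

(* e is a basis of the generic fibre, g P is the matrix expressing some frame
   of E near P in terms of e, and e itself is a frame almost everywhere. *)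
Definition framed_by (n : nat) E (e : 'I_n -> V) (g : closed_point i -> 'M[K]_n)
    : Prop :=
  [/\ independent e,
      forall P, g P \in unitmx,
      finite_set [set P | g P <> 1%:M]
    & forall P, E P = local_span P (fun j => \sum_(l < n) g P j l *: e l)].

Definition vector_bundle (n : nat) E : Prop := exists e g, @framed_by n E e g.

(* The degree of det E: the rational section e_1 /\ ... /\ e_n of det E is
   (det (g P))^-1 times a generator near P. *)
Definition degree (n : nat) E : int :=
  xget 0 [set d | exists (e : 'I_n -> V) (g : closed_point i -> 'M[K]_n),
     framed_by E e g /\
     d = - \sum_(P \in [set: closed_point i]) P (\det (g P))].

(* M is a rank 1 bundle that is locally a direct summand of E. *)
Definition line_subbundle M E : Prop :=
  vector_bundle 1 M /\
  forall P, exists e : 'I_2 -> V,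
    [/\ independent e, E P = local_span P e
      & M P = local_span P (fun _ : 'I_1 => e ord0)].

Definition stable2 E : Prop :=
  vector_bundle 2 E /\
  forall M, line_subbundle M E ->
    (degree 1 M)%:~R < (degree 2 E)%:~R / 2 :> rat.

End Bundles.

(* Line bundles are taken as rank 1 bundles with generic fibre K. *)
Definition line_sheaf : Type := closed_point i -> set K^o.

Definition isomorphic_lines (L L' : line_sheaf) : Prop :=
  exists2 h : K, h != 0 & forall P, L' P = [set h * s | s in L P].

Definition pic_class (L : line_sheaf) : set line_sheaf :=
  [set L' | isomorphic_lines L L'].

Definition pic0 : set (set line_sheaf) :=
  [set pic_class L | L in [set L | vector_bundle 1 L /\ degree 1 L = 0]].

(* The line bundle O(D) of a divisor D. *)
Definition line_of_divisor (D : closed_point i -> int) : line_sheaf :=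
  fun P => [set h | h = 0 \/ - D P <= P h].

Definition point_divisor P : closed_point i -> int := fun Q => (Q == P)%:Z.
Definition polar_divisor a : closed_point i -> int :=
  fun Q => Num.max 0 (- Q a).

(* Zariski topology of Pic^0 of a curve C of genus 2, D0 being a divisor of
   degree 2: the morphism C x C -> Pic^0, (P, Q) |-> O(P + Q - D0), is proper
   and surjective, so Pic^0 carries the quotient topology; another choice of D0
   changes this morphism by a translation of Pic^0. *)
Definition pic0_open_genus2 (D0 : closed_point i -> int)
    (U : set (set line_sheaf)) : Prop :=
  U `<=` pic0 /\
  zariski_open2 [set PQ | U (pic_class (line_of_divisor
    (fun Q => point_divisor PQ.1 Q + point_divisor PQ.2 Q - D0 Q)))].

End Curve.

(* L as a K-vector space through f : K -> L. *)
Definition restrict_scalars (K L : fieldType) (f : {rmorphism K -> L}) : Type :=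
  L.

Section RestrictScalars.
Variables (K L : fieldType) (f : {rmorphism K -> L}).
Local Notation W := (restrict_scalars f).
HB.instance Definition _ := GRing.Zmodule.copy W L.

Let scale (a : K) (v : W) : W := f a * (v : L).
Fact restrict_scalarsA a b v : scale a (scale b v) = scale (a * b) v.
Proof. by rewrite /scale rmorphM mulrA. Qed.
Fact restrict_scalars1 : left_id 1 scale.
Proof. by move=> v; rewrite /scale rmorph1 mul1r. Qed.
Fact restrict_scalarsDr : right_distributive scale +%R.
Proof. by move=> a u v; rewrite /scale mulrDr. Qed.
Fact restrict_scalarsDl v : {morph scale^~ v : a b / a + b}.
Proof. by move=> a b; rewrite /scale rmorphD mulrDl. Qed.
HB.instance Definition _ := GRing.Zmodule_isLmodule.Build K W
  restrict_scalarsA restrict_scalars1 restrict_scalarsDr restrict_scalarsDl.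
End RestrictScalars.

(* A nonconstant morphism f : C -> E of curves is given by the inclusion fs of
   function fields; f P = p when the local ring of P contracts to that of p. *)
Section Morphism.
Variables (k KE KC : fieldType).
Variables (iE : {rmorphism k -> KE}) (iC : {rmorphism k -> KC}).
Variable fs : {rmorphism KE -> KC}.

Definition maps_to (P : closed_point iC) (p : closed_point iE) : Prop :=
  forall a : KE, regular_at p a <-> regular_at P (fs a).

Definition direct_image (L : line_sheaf iC)
    : closed_point iE -> set (restrict_scalars fs) :=
  fun p => [set h | forall P, maps_to P p -> L P h].

End Morphism.

Arguments direct_image {k KE KC} iE {iC} fs L.

(* Main.v *)
(* Let sg be the involution of C over E. For L of degree 0 the bundle f_* L has
   degree -1, so it is stable as soon as it has no line subbundle M of degree
   >= 0. By adjunction such an M gives a nonzero section of L (x) f^* M^-1, hence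
   deg M = 0 and L = f^* M, so that sg^* L = L. If L = O(P + Q - D0), D0 being
   invariant under sg, this means that P + Q and sg P + sg Q are linearly
   equivalent. A function on the genus 2 curve C whose poles are at most P + Q,
   where xi(P) <> xi(Q), is constant, hence {P, Q} = {sg P, sg Q}, which is
   impossible if xi(P)^2 <> xi(Q)^2. By the same property of functions the open
   set xi(P)^2 <> xi(Q)^2 of C x C is saturated for linear equivalence, so it is
   the preimage of an open subset of Pic^0(C).

   Points, degrees of divisors and degrees of direct images are transported
   through the quadratic extensions k(x) < K(E) < K(C) and k(xi) < K(C) by means
   of the norm, starting from the projective line. *)
Require Import Defs.
From HB Require Import structures.
From mathcomp Require Import all_boot all_order all_algebra.
From mathcomp Require Import complex.
From mathcomp Require Import all_classical reals.
From mathcomp Require Import zify ring.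

Set Implicit Arguments.
Unset Strict Implicit.
Unset Printing Implicit Defensive.

Import Order.TTheory GRing.Theory Num.Theory.

Local Open Scope classical_set_scope.
Local Open Scope ring_scope.

(** Closed points are abstract valuations, so their existence, their residue fields and the degree 0
    of principal divisors all have to be constructed. Every field involved lies above a field of
    rational functions by one or two quadratic steps, and there the trace and the norm of [a + b w]
    do the work of normalization and of Riemann-Roch. The function field of [C] is used in two ways:
    over that of [E], with the involution [xi |-> - xi], for direct images; over [k(xi)], with
    [w = eta], for functions with two poles. The genus of [C] enters only through the sextic, which
    has simple roots and a pole of order 6. The degree -1 arises because [t' - x] has a double pole
    at the point at infinity [o] of [E] and otherwise only simple zeros: then
    [f_* O = O + O(-o) xi]. *)

Ltac ilia := intros; lia.

(** * Discrete valuations *)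

Lemma mulz_eq1_ge0 (m n : int) : 0 <= n -> 1 = m * n -> n = 1.
Proof.
move=> n0 /(congr1 absz); rewrite abszM => /esym/eqP; rewrite muln_eq1.
case/andP => _ /eqP; ilia.
Qed.

Section Valuation.
Variables (k K : fieldType) (i : {rmorphism k -> K}).
Implicit Types (P Q : closed_point i) (a b z : K) (n m : int) (c : k).

Lemma closed_point_eq P Q : (forall a, a != 0 -> P a = Q a) -> P = Q.
Proof.
move=> PQ; have {PQ} : valuation P = valuation Q.
  apply/funext => a; have [->|/PQ//] := eqVneq a 0.
  by rewrite !valuation0.
case: P Q => [v v0 vM vD vc vu] [w w0 wM wD wc wu] /= vw.
case: _ / vw w0 wM wD wc wu => w0 wM wD wc wu.
by congr ClosedPoint; exact: Prop_irrelevance.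
Qed.

Lemma val1 P : P 1 = 0.
Proof. by rewrite -(rmorph1 i) valuation_const ?oner_eq0. Qed.

Lemma valN1 P : P (-1) = 0.
Proof. by rewrite -(rmorph1 i) -rmorphN valuation_const ?oppr_eq0 ?oner_eq0. Qed.

Lemma valN P a : P (- a) = P a.
Proof.
have [->|a0] := eqVneq a 0; first by rewrite oppr0.
by rewrite -mulN1r valuationM ?oppr_eq0 ?oner_eq0// valN1 add0r.
Qed.

Lemma valV P a : P a^-1 = - P a.
Proof.
have [->|a0] := eqVneq a 0; first by rewrite invr0 valuation0 oppr0.
have := valuationM P a0 (invr_neq0 a0); rewrite divff// val1; ilia.
Qed.

Lemma val_div P a b : a != 0 -> b != 0 -> P (a / b) = P a - P b.
Proof. by move=> a0 b0; rewrite valuationM ?invr_eq0// valV. Qed.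

Lemma valX P a (n : nat) : a != 0 -> P (a ^+ n) = n%:Z * P a.
Proof.
move=> a0; elim: n => [|n IHn]; first by rewrite expr0 val1 mul0r.
by rewrite exprS valuationM ?expf_neq0// IHn intS mulrDl mul1r.
Qed.

Lemma valXz P a n : a != 0 -> P (a ^ n) = n * P a.
Proof.
move=> a0; case: n => n; first exact: valX.
by rewrite NegzE -exprnN valV valX// mulNr.
Qed.

(** The order of 0 counts as infinite here, which the dummy value cannot express. [regular_at] and
    [vanishes_at] are convertible to the cases [n = 0] and [n = 1], and the proofs pass between them
    silently. *)
Definition val_ge P n a := a = 0 \/ n <= P a.

Lemma val_ge_vanishes P a : vanishes_at P a <-> val_ge P 1 a.
Proof. by []. Qed.

Lemma val_geN P n a : val_ge P n a -> val_ge P n (- a).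
Proof. by case=> [->|nP]; [left; rewrite oppr0|right; rewrite valN]. Qed.

Lemma val_geD P n a b : val_ge P n a -> val_ge P n b -> val_ge P n (a + b).
Proof.
case=> [->|na]; first by rewrite add0r.
case=> [->|nb]; first by rewrite addr0; right.
have [->|a0] := eqVneq a 0; first by rewrite add0r; right.
have [->|b0] := eqVneq b 0; first by rewrite addr0; right.
have [->|ab0] := eqVneq (a + b) 0; first by left.
right; apply: le_trans (valuationD P a0 b0 ab0); rewrite le_min; exact/andP.
Qed.

Lemma val_geB P n a b : val_ge P n a -> val_ge P n b -> val_ge P n (a - b).
Proof. by move=> na /val_geN; exact: val_geD. Qed.

Lemma val_geM P n m a b : val_ge P n a -> val_ge P m b -> val_ge P (n + m) (a * b).
Proof.
case=> [->|na]; first by rewrite mul0r; left.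
case=> [->|nb]; first by rewrite mulr0; left.
have [->|a0] := eqVneq a 0; first by rewrite mul0r; left.
have [->|b0] := eqVneq b 0; first by rewrite mulr0; left.
by right; rewrite valuationM//; ilia.
Qed.

Lemma val_ge_le P n m a : m <= n -> val_ge P n a -> val_ge P m a.
Proof. by move=> mn [->|na]; [left|right; ilia]. Qed.

Lemma val_geP P n a : a != 0 -> val_ge P n a -> n <= P a.
Proof. by move=> /eqP a0 []. Qed.

Lemma val_ge_const P c : val_ge P 0 (i c).
Proof.
have [->|c0] := eqVneq c 0; first by left; rewrite rmorph0.
by right; rewrite valuation_const.
Qed.

Lemma val_ge_refl P a : val_ge P (P a) a.
Proof. by right. Qed.

Lemma val_ge_div P n m a b : b != 0 -> P b <= m -> val_ge P (n + m) a ->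
  val_ge P n (a / b).
Proof.
move=> b0 bm /val_geM/(_ (val_ge_refl P b^-1)).
by rewrite valV; apply: val_ge_le; ilia.
Qed.

Lemma val_addl P a b : a != 0 -> val_ge P (P a + 1) b -> P (a + b) = P a.
Proof.
move=> a0 hb; have ab0 : a + b != 0.
  apply/negP => /eqP/(canRL (addrK _)); rewrite sub0r => ab.
  have b0 : b != 0 by rewrite -oppr_eq0 -ab.
  by move: (val_geP b0 hb); rewrite ab valN; ilia.
have h1 : P a <= P (a + b).
  apply: val_geP ab0 _; apply: val_geD (val_ge_refl _ _) _.
  by apply: val_ge_le hb; ilia.
have [h2|lt_ab] : P (a + b) <= P a \/ P a + 1 <= P (a + b) by ilia.
  by ilia.
have hh : val_ge P (P a + 1) a; last by move: (val_geP a0 hh); ilia.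
by rewrite -{2}[a](addrK b); apply: val_geB => //; right.
Qed.

(** A valuation ring determines its units, so [Q] is [P] multiplied by [Q u], with [u] a uniformizer
    of [P]; as [Q] takes the value 1, this factor is 1. *)
Lemma eq_regular_point P Q : (forall a, regular_at P a <-> regular_at Q a) -> P = Q.
Proof.
move=> PQ; have unit a : a != 0 -> P a = 0 -> Q a = 0.
  move=> a0 Pa.
  have /PQ/(val_geP a0) : regular_at P a by right; ilia.
  have /PQ/(val_geP (invr_neq0 a0)) : regular_at P a^-1 by right; rewrite valV; ilia.
  by rewrite valV; ilia.
have [u u0 Pu] := valuation_unif P.
have PQE a : a != 0 -> Q a = P a * Q u.
  move=> a0; have upa0 : u ^ P a != 0 by rewrite expfz_neq0.
  have := @unit (a / u ^ P a); rewrite !val_div// !valXz// Pu.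
  rewrite mulf_eq0 invr_eq0 negb_or a0 upa0; ilia.
have [v v0 Qv] := valuation_unif Q.
have : regular_at Q u by apply/PQ; right; rewrite Pu.
move/(val_geP u0); move: (PQE _ v0); rewrite Qv => h h'.
have Qu := mulz_eq1_ge0 h' h.
by apply: closed_point_eq => a a0; rewrite PQE// Qu mulr1.
Qed.

(** The residue of [z] at [P], as a relation: that every regular function has one is a property of
    the point, proved when the point is constructed. *)
Definition has_val P z c := vanishes_at P (z - i c).

Definition residually_constant P :=
  forall z, regular_at P z -> exists c, has_val P z c.

Lemma has_val_regular P z c : has_val P z c -> regular_at P z.
Proof.
move=> zc; rewrite -[z](subrK (i c)); apply: val_geD (val_ge_const _ _).
exact: (@val_ge_le _ 1).
Qed.

Lemma has_val_const P c : has_val P (i c) c.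
Proof. by left; rewrite subrr. Qed.

Lemma has_valD P z z' c c' :
  has_val P z c -> has_val P z' c' -> has_val P (z + z') (c + c').
Proof.
move=> zc zc'; rewrite /has_val rmorphD opprD addrACA; exact: (@val_geD P 1).
Qed.

Lemma has_valM P z z' c c' :
  has_val P z c -> has_val P z' c' -> has_val P (z * z') (c * c').
Proof.
move=> zc zc'; rewrite /has_val.
have -> : z * z' - i (c * c') = (z - i c) * z' + i c * (z' - i c').
  by rewrite rmorphM; ring.
apply: (@val_geD P 1).
  exact: (@val_geM _ 1 0 _ _ zc (has_val_regular zc')).
exact: (@val_geM _ 0 1 _ _ (val_ge_const _ _) zc').
Qed.

Lemma has_valN P z c : has_val P z c -> has_val P (- z) (- c).
Proof.
by move=> zc; rewrite /has_val rmorphN -opprD; exact: (@val_geN P 1).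
Qed.

Lemma has_valB P z z' c c' :
  has_val P z c -> has_val P z' c' -> has_val P (z - z') (c - c').
Proof. by move=> zc /has_valN; exact: has_valD. Qed.

Lemma has_val_inj P z c c' : has_val P z c -> has_val P z c' -> c = c'.
Proof.
move=> zc zc'; apply/eqP/negPn; rewrite -subr_eq0; apply/negP => cc'.
have := @val_geB P 1 _ _ zc' zc; rewrite opprB addrC subrKA -rmorphB => h.
have := val_geP _ h; rewrite fmorph_eq0 => /(_ cc').
by rewrite valuation_const.
Qed.

Lemma has_val0E P z : has_val P z 0 <-> val_ge P 1 z.
Proof. by rewrite /has_val rmorph0 subr0. Qed.

Lemma has_val_unit P z c : has_val P z c -> c != 0 -> z != 0 /\ P z = 0.
Proof.
move=> zc c0; have ic0 : i c != 0 by rewrite fmorph_eq0.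
have := @val_addl P (i c) (z - i c) ic0.
rewrite valuation_const// [i c + _]addrC subrK => /(_ zc) ->; split=> //.
apply: contra_neq c0 => z0; apply: (has_val_inj zc).
by apply/has_val0E; left.
Qed.

Lemma has_val_neq0 P z c : z != 0 -> P z = 0 -> has_val P z c -> c != 0.
Proof.
move=> z0 Pz zc; apply/eqP => c0; move: zc.
by rewrite c0 => /has_val0E/(val_geP z0); rewrite Pz.
Qed.

Lemma has_valV P z c : has_val P z c -> c != 0 -> has_val P z^-1 c^-1.
Proof.
move=> zc c0; have [z0 Pz] := has_val_unit zc c0.
have ic0 : i c != 0 by rewrite fmorph_eq0.
rewrite /has_val fmorphV; have -> : z^-1 - (i c)^-1 = - ((z - i c) / (z * i c)).
  by field; apply/andP.
apply: (@val_geN P 1); apply: (@val_ge_div _ 1 0); last by rewrite addr0.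
  by rewrite mulf_neq0.
by rewrite valuationM// valuation_const// Pz.
Qed.

Lemma valueE P z c : has_val P z c -> value P z = c.
Proof.
move=> zc; rewrite /value.
apply: (has_val_inj _ zc).
exact: (@xgetPex _ 0 [set c | vanishes_at P (z - i c)] (ex_intro _ c zc)).
Qed.

(* The localization of the algebra {z | G z c for some c} at the kernel of
   its residue map z |-> c is a discrete valuation ring with uniformizer pi. *)
Lemma localization_point (G : K -> k -> Prop) (pi : K) :
    (forall c, G (i c) c) ->
    (forall z z' c c', G z c -> G z' c' -> G (z + z') (c + c')) ->
    (forall z z' c c', G z c -> G z' c' -> G (z * z') (c * c')) ->
    (forall c, G 0 c -> c = 0) -> pi != 0 -> G pi 0 ->
    (forall z, z != 0 -> exists n x s cx cs,
       [/\ G x cx, G s cs, cx != 0, cs != 0 & z = pi ^ n * (x / s)]) ->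
  exists P, [/\ forall z c, G z c -> has_val P z c, P pi = 1,
     residually_constant P
   & forall Q, (forall z, G z 0 -> vanishes_at Q z) -> Q = P].
Proof.
move=> Gc GD GM G0 pi0 Gpi dec.
have Gneq0 x c : G x c -> c != 0 -> x != 0.
  by move=> Gx; apply: contra_neq => x0; apply: G0; rewrite -x0.
have GX (n : nat) : G (pi ^+ n.+1) 0.
  elim: n => // n IHn; rewrite exprS -(mulr0 0); exact: GM.
pose rep z n := exists x s cx cs,
  [/\ G x cx, G s cs, cx != 0, cs != 0 & z = pi ^ n * (x / s)].
(* A negative [n] would make [x] a multiple of [pi], with residue 0 besides [cx]; by subtraction 0
   would have the nonzero residue [cx]. *)
have rep_ge0 z c n : G z c -> rep z n -> 0 <= n.
  move=> Gz [x [s [cx [cs [Gx Gs cx0 cs0 zE]]]]]; case: n zE => // n.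
  have s0 := Gneq0 _ _ Gs cs0; have x0 := Gneq0 _ _ Gx cx0.
  rewrite NegzE -exprnN => zE.
  have xE : x = pi ^+ n.+1 * (z * s).
    rewrite zE; field; by rewrite s0 expf_neq0.
  have := GM _ _ _ _ (GX n) (GM _ _ _ _ Gz Gs); rewrite -xE mul0r => Gx0.
  have := GD _ _ _ _ Gx (GM _ _ _ _ (Gc (-1)) Gx0).
  rewrite rmorphN rmorph1 mulN1r subrr mulr0 addr0 => /G0 cx00.
  by rewrite cx00 eqxx in cx0.
have repM z z' n n' : rep z n -> rep z' n' -> rep (z * z') (n + n').
  move=> [x [s [cx [cs [Gx Gs cx0 cs0 ->]]]]].
  move=> [x' [s' [cx' [cs' [Gx' Gs' cx'0 cs'0 ->]]]]].
  exists (x * x'), (s * s'), (cx * cx'), (cs * cs'); rewrite !mulf_neq0//.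
  split=> //; try exact: GM.
  by rewrite expfzDr// invfM; ring.
have repV z n : rep z n -> rep z^-1 (- n).
  move=> [x [s [cx [cs [Gx Gs cx0 cs0 ->]]]]].
  exists s, x, cs, cx; split=> //.
  by rewrite invfM invf_div invr_expz.
have rep_uniq z n n' : rep z n -> rep z n' -> n = n'.
  move=> zn zn'; have z0 : z != 0.
    case: zn => [x [s [cx [cs [Gx Gs cx0 cs0 ->]]]]].
    by rewrite !mulf_neq0 ?expfz_neq0 ?invr_eq0//; [exact: Gneq0 Gx cx0|exact: Gneq0 Gs cs0].
  have := repM _ _ _ _ zn (repV _ _ zn'); have := repM _ _ _ _ zn' (repV _ _ zn).
  have G1 := Gc 1; rewrite rmorph1 in G1.
  rewrite divff// => /(rep_ge0 _ _ _ G1) h1 /(rep_ge0 _ _ _ G1) h2; ilia.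
pose v z : int := if z == 0 then 0 else xget 0 (rep z).
have vP z : z != 0 -> rep z (v z).
  move=> z0; rewrite /v (negPf z0); case: (dec z z0) => n rz.
  exact: (@xgetPex _ 0 (rep z) (ex_intro _ n rz)).
have v0 : v 0 = 0 by rewrite /v eqxx.
have vM z z' : z != 0 -> z' != 0 -> v (z * z') = v z + v z'.
  move=> z0 z'0; apply: rep_uniq (vP _ (mulf_neq0 z0 z'0)) _.
  by apply: repM; exact: vP.
have vV z : z != 0 -> v z^-1 = - v z.
  move=> z0; apply: rep_uniq (vP _ (invr_neq0 z0)) _.
  by apply: repV; exact: vP.
have v_ge0 z c : z != 0 -> G z c -> 0 <= v z.
  by move=> z0 Gz; exact: rep_ge0 Gz (vP z z0).
have v_unit x c : G x c -> c != 0 -> v x = 0.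
  move=> Gx c0; have x0 := Gneq0 _ _ Gx c0.
  apply: rep_uniq (vP _ x0) _; exists x, 1, c, 1; split=> //.
  - by rewrite -(rmorph1 i).
  - exact: oner_neq0.
  by rewrite expr0z divr1 mul1r.
have vpi : v pi = 1.
  apply: rep_uniq (vP _ pi0) _; exists 1, 1, 1, 1; rewrite oner_eq0; split=> //.
  - by rewrite -(rmorph1 i).
  - by rewrite -(rmorph1 i).
  by rewrite expr1z divr1 mulr1.
have vX n : v (pi ^ n) = n.
  apply: rep_uniq (vP _ _) _; rewrite ?expfz_neq0//.
  exists 1, 1, 1, 1; rewrite oner_eq0; split=> //.
  - by rewrite -(rmorph1 i).
  - by rewrite -(rmorph1 i).
  by rewrite divr1 mulr1.
have v_ge0D z z' : z != 0 -> z' != 0 -> z + z' != 0 -> v z <= v z' ->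
    v z <= v (z + z').
  move=> z0 z'0 zz'0 zz'.
  case: (vP _ z0) => [x [s [cx [cs [Gx Gs cx0 cs0 zE]]]]].
  case: (vP _ z'0) => [x' [s' [cx' [cs' [Gx' Gs' cx'0 cs'0 z'E]]]]].
  have s0 := Gneq0 _ _ Gs cs0; have s'0 := Gneq0 _ _ Gs' cs'0.
  (* Over the common factor [pi ^ v z] the sum has numerator [x * s' + pi ^+ m * (x' * s)], again an
     element with a residue. *)
  pose m := `|v z' - v z|%N.
  have mE : v z' = v z + m%:Z by rewrite /m; ilia.
  have [c Gm] : exists c, G (x * s' + pi ^+ m * (x' * s)) c.
    have [cm Gm] : exists c, G (pi ^+ m) c.
      by case: (m) => [|m']; [exists 1; rewrite expr0 -(rmorph1 i)|exists 0].
    exists (cx * cs' + cm * (cx' * cs)); apply: GD; first exact: GM.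
    by apply: (GM) => //; exact: GM.
  have E : z + z' = pi ^ v z * ((x * s' + pi ^+ m * (x' * s)) / (s * s')).
    rewrite {1}zE {1}z'E mE expfzDr//.
    have -> : pi ^ (m%:Z) = pi ^+ m by [].
    by field; rewrite s0 s'0.
  have y0 : x * s' + pi ^+ m * (x' * s) != 0.
    by apply: contra_neq zz'0; rewrite E => ->; rewrite mul0r mulr0.
  rewrite E vM ?mulf_neq0 ?invr_eq0 ?expfz_neq0 ?mulf_neq0// vX.
  rewrite (vM _ (_^-1)) ?invr_eq0 ?mulf_neq0// vV ?mulf_neq0//.
  rewrite (v_unit (s * s') (cs * cs')) ?mulf_neq0//; last exact: GM.
  by have := v_ge0 _ _ y0 Gm; ilia.
have vD z z' : z != 0 -> z' != 0 -> z + z' != 0 -> Num.min (v z) (v z') <= v (z + z').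
  move=> z0 z'0 zz'0; have [h|h] : v z <= v z' \/ v z' < v z by ilia.
    by rewrite min_l//; apply: v_ge0D.
  rewrite min_r; last exact: ltW.
  by rewrite addrC; apply: v_ge0D => //; [rewrite addrC|exact: ltW].
have vc c : c != 0 -> v (i c) = 0 by move=> c0; exact: v_unit (Gc c) c0.
pose P := ClosedPoint v0 vM vD vc (ex_intro2 _ _ pi pi0 vpi).
have PG z c : G z c -> has_val P z c.
  move=> Gz; rewrite /has_val.
  have [->|zc] := eqVneq (z - i c) 0; first by left.
  right; have Gzc : G (z - i c) 0.
    rewrite -(subrr c); apply: GD => //; rewrite -rmorphN; exact: Gc.
  rewrite lt_neqAle (v_ge0 _ _ zc Gzc) andbT; apply/negP => /eqP/esym Pzc.
  have {}Pzc : v (z - i c) = 0 := Pzc.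
  case: (vP _ zc); rewrite Pzc => x [s [cx [cs [Gx Gs cx0 cs0]]]].
  rewrite expr0z mul1r => zE; have s0 := Gneq0 _ _ Gs cs0.
  have xE : x = (z - i c) * s by rewrite zE; field.
  have := GD _ _ _ _ Gx (GM _ _ _ _ (Gc (-1)) (GM _ _ _ _ Gzc Gs)).
  rewrite -xE rmorphN rmorph1 mulN1r subrr mul0r mulr0 addr0 => /G0 cx00.
  by rewrite cx00 eqxx in cx0.
exists P; split=> //.
  move=> z [->|Pz]; first by exists 0; left; rewrite rmorph0 subrr.
  have [->|z0] := eqVneq z 0; first by exists 0; left; rewrite rmorph0 subrr.
  case: (ltgtP 0 (P z)) Pz => // Pz _; first by exists 0; rewrite /has_val rmorph0 subr0; right.
  case: (vP _ z0) => x [s [cx [cs [Gx Gs cx0 cs0]]]].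
  rewrite -[v z]/(P z) -Pz expr0z mul1r => ->; exists (cx / cs).
  apply: has_valM; first exact: PG.
  by apply: has_valV => //; exact: PG.
(* Elements with nonzero residue are units at [Q], so [Q] is [Q pi] times the constructed valuation,
   and normalization gives [Q pi = 1]. *)
move=> Q GQ.
have Qunit x c : G x c -> c != 0 -> Q x = 0.
  move=> Gx c0; apply: (proj2 (@has_val_unit Q x c _ c0)); apply: GQ.
  by rewrite -(subrr c); apply: GD => //; rewrite -rmorphN; exact: Gc.
have Qpi : 0 < Q pi.
  by have := GQ _ Gpi => /val_ge_vanishes/(val_geP pi0).
have QE z : z != 0 -> Q z = v z * Q pi.
  move=> z0; case: (vP _ z0) => x [s [cx [cs [Gx Gs cx0 cs0 {1}->]]]].
  have s0 := Gneq0 _ _ Gs cs0; have x0 := Gneq0 _ _ Gx cx0.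
  rewrite valuationM ?expfz_neq0 ?mulf_neq0 ?invr_eq0// val_div//.
  by rewrite (Qunit _ _ Gx)// (Qunit _ _ Gs)// valXz// subrr addr0.
have [u u0 Qu] := valuation_unif Q.
have Qpi1 : Q pi = 1 by apply: (mulz_eq1_ge0 (m := v u) (ltW Qpi)); rewrite -QE.
by apply: closed_point_eq => z z0; rewrite QE// Qpi1 mulr1.
Qed.

End Valuation.

(** * Finitely supported integer sums *)

Definition fsum (T : choiceType) (f : T -> int) : int := \sum_(x \in [set: T]) f x.

Section FiniteSums.
Variable T : choiceType.
Implicit Types f g : T -> int.

Definition finite_supp f := finite_set [set x | f x <> 0].

Lemma finite_supp_sub f g :
  (forall x, f x = 0 -> g x = 0) -> finite_supp f -> finite_supp g.
Proof. by move=> fg; apply: sub_finite_set => x /= gx /fg. Qed.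

Lemma finite_suppD f g :
  finite_supp f -> finite_supp g -> finite_supp (fun x => f x + g x).
Proof.
move=> hf hg; have hfg : finite_set ([set x | f x <> 0] `|` [set x | g x <> 0]).
  by rewrite finite_setU.
apply: sub_finite_set hfg => x /= fgx; apply: contrapT => /not_orP[/contrapT f0 /contrapT g0].
by apply: fgx; rewrite f0 g0.
Qed.

Lemma finite_suppN f : finite_supp f -> finite_supp (fun x => - f x).
Proof. by apply: finite_supp_sub => x ->. Qed.

Lemma finite_supp0 : finite_supp (fun=> 0).
Proof. by rewrite /finite_supp; apply: sub_finite_set (finite_set0 _) => x /=. Qed.

Lemma finite_supp_pt a n : finite_supp (fun x => (x == a)%:Z * n).
Proof.
apply: sub_finite_set (finite_set1 a) => x /= h; apply/eqP; apply: contra_notT h.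
by move/negPf ->; rewrite mul0r.
Qed.

Lemma finite_supp_seq f : finite_supp f ->
  exists2 s : seq T, uniq s & forall x, f x != 0 -> x \in s.
Proof.
move=> /finite_seqP[s fs]; exists (undup s); first exact: undup_uniq.
move=> x /eqP fx; rewrite mem_undup.
by have : [set` s] x by rewrite -fs.
Qed.

Lemma fsum_seq f (s : seq T) : uniq s -> (forall x, f x != 0 -> x \in s) ->
  fsum f = \sum_(x <- s) f x.
Proof.
rewrite /fsum; move=> us fs; rewrite (fsbigE s)//; first by apply: eq_bigl => x; rewrite in_setT.
by move=> x _ xs; apply/eqP; apply: contraNT xs; exact: fs.
Qed.

Lemma fsumD f g : finite_supp f -> finite_supp g ->
  fsum (fun x => f x + g x) = fsum f + fsum g.
Proof.
move=> /finite_supp_seq[s us fs] /finite_supp_seq[r ur gr].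
have u : uniq (undup (s ++ r)) by exact: undup_uniq.
rewrite !(fsum_seq u) ?big_split// => x.
- by rewrite mem_undup mem_cat => /gr ->; rewrite orbT.
- by rewrite mem_undup mem_cat => /fs ->.
rewrite mem_undup mem_cat => fg; apply/orP.
have [fx|/fs ->] := eqVneq (f x) 0; last by left.
by right; apply: gr; apply: contra_neq fg => ->; rewrite fx.
Qed.

Lemma fsumN f : fsum (fun x => - f x) = - fsum f.
Proof. by rewrite /fsum -mulN1r mulr_fsumr; apply: eq_fsbigr => x _; rewrite mulN1r. Qed.

Lemma fsum0 : fsum (fun _ : T => 0) = 0.
Proof. by rewrite /fsum fsbig1. Qed.

Lemma fsum_pt a n : fsum (fun x : T => (x == a)%:Z * n) = n.
Proof.
rewrite (@fsum_seq _ [:: a])//; first by rewrite big_seq1 eqxx mul1r.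
by move=> x; rewrite inE; apply: contraNT => /negPf ->; rewrite mul0r.
Qed.

Lemma fsum_ge0 f : (forall x, 0 <= f x) -> 0 <= fsum f.
Proof. by move=> f0; exact: fsumr_ge0. Qed.

Lemma fsum_eq0 f : finite_supp f -> (forall x, 0 <= f x) ->
  fsum f = 0 -> forall x, f x = 0.
Proof.
move=> /finite_supp_seq[s us fs] f0; rewrite (fsum_seq us fs) => /eqP.
rewrite psumr_eq0// => /allP h x; apply/eqP; apply/negPn/negP => fx.
by move: (h x (fs x fx)) => /= /eqP fx0; rewrite fx0 eqxx in fx.
Qed.

End FiniteSums.

(** The sum is reordered along the fibres of [pi]. Each fibre comes with an explicit list, since on
    a double cover it consists of one or two named points. *)
Lemma fsum_fibres (T T' : choiceType) (pi : T -> T') (f : T -> int) (g : T' -> int) :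
  finite_supp f ->
  (forall y, exists s, [/\ uniq s, forall x, (x \in s) = (pi x == y)
     & g y = \sum_(x <- s) f x]) ->
  finite_supp g /\ fsum f = fsum g.
Proof.
move=> /finite_supp_seq[s us fs] fib; set r := undup (map pi s).
have gr y : g y = \sum_(x <- s | pi x == y) f x.
  case: (fib y) => t [ut tE ->].
  pose h x := if pi x == y then f x else 0.
  have -> : \sum_(x <- t) f x = \sum_(x <- t) h x.
    by apply: eq_big_seq => x; rewrite tE /h => ->.
  rewrite -(fsum_seq ut); last by move=> x; rewrite tE /h; case: ifP => //; rewrite eqxx.
  rewrite (@fsum_seq _ h s)//; last first.
    by move=> x hx; apply: fs; move: hx; rewrite /h; case: ifP => //; rewrite eqxx.
  by rewrite [RHS]big_mkcond.
have grs y : g y != 0 -> y \in r.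
  apply: contraNT; rewrite mem_undup gr => yr; rewrite big1_seq// => x /andP[/eqP xy xs].
  by case/negP: yr; rewrite -xy map_f.
split.
  apply: sub_finite_set (finite_seq r) => y /= /eqP; exact: grs.
rewrite (fsum_seq us fs) (fsum_seq (undup_uniq _) grs).
under [RHS]eq_bigr do rewrite gr.
rewrite (exchange_big_dep xpredT)//=; apply: eq_big_seq => x xs.
rewrite -big_filter.
have -> : [seq y <- r | pi x == y] = [:: pi x]; last by rewrite big_seq1.
rewrite (eq_filter (a2 := pred1 (pi x))); last by move=> y; rewrite /= eq_sym.
by rewrite filter_pred1_uniq ?undup_uniq// mem_undup map_f.
Qed.

(** * The projective line *)

Section Line.
Variables (k : closedFieldType) (K : fieldType) (i : {rmorphism k -> K}).
Implicit Types (T z : K) (q n d : {poly k}) (c : k) (P Q : closed_point i).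

Definition evp T q := (map_poly i q).[T].

Lemma evpD T q q' : evp T (q + q') = evp T q + evp T q'.
Proof. by rewrite /evp rmorphD hornerD. Qed.

Lemma evpN T q : evp T (- q) = - evp T q.
Proof. by rewrite /evp rmorphN hornerN. Qed.

Lemma evpM T q q' : evp T (q * q') = evp T q * evp T q'.
Proof. by rewrite /evp rmorphM hornerM. Qed.

Lemma evpC T c : evp T c%:P = i c.
Proof. by rewrite /evp map_polyC hornerC. Qed.

Lemma evpX T : evp T 'X = T.
Proof. by rewrite /evp map_polyX hornerX. Qed.

Lemma evpXn T m : evp T 'X^m = T ^+ m.
Proof. by rewrite /evp map_polyXn hornerXn. Qed.

Lemma evpXsubC T c : evp T ('X - c%:P) = T - i c.
Proof. by rewrite evpD evpX evpN evpC. Qed.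

Definition line_generator T :=
  (forall q, evp T q = 0 -> q = 0) /\
  (forall z, exists n d, evp T d != 0 /\ z = evp T n / evp T d).

Lemma evp_neq0 T q : line_generator T -> q != 0 -> evp T q != 0.
Proof. by move=> [inj _]; apply: contra_neq; exact: inj. Qed.

Lemma line_generator_sub_neq0 T c : line_generator T -> T - i c != 0.
Proof. by move=> gT; rewrite -evpXsubC evp_neq0// polyXsubC_eq0. Qed.
Arguments line_generator_sub_neq0 {T} c _.

Lemma line_generator_neq0 T : line_generator T -> T != 0.
Proof. by move=> /(line_generator_sub_neq0 0); rewrite rmorph0 subr0. Qed.

(** The reciprocal polynomial: it exchanges [T] and [T^-1], so that infinity becomes the point
    [T^-1 = 0]. *)
Definition revp q := \poly_(j < size q) q`_((size q).-1 - j).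

Lemma evp_revp T q : T != 0 -> evp T q = T ^+ (size q).-1 * evp T^-1 (revp q).
Proof.
move=> T0; rewrite /evp.
rewrite (@horner_coef_wide _ (size q)) ?size_map_poly//.
rewrite (@horner_coef_wide _ (size q) (map_poly _ (revp q))); last first.
  by rewrite size_map_poly size_poly.
rewrite (reindex_inj rev_ord_inj) mulr_sumr; apply: eq_bigr => j _ /=.
rewrite !coef_map coef_poly ltn_ord /= mulrCA.
have jq : (size q - j.+1 = (size q).-1 - j)%N by have := ltn_ord j; lia.
rewrite jq; congr (_ * _).
rewrite -[in RHS](subnK (_ : j <= (size q).-1)%N); last by have := ltn_ord j; lia.
by rewrite exprD -mulrA -exprMn divff// expr1n mulr1.
Qed.

Lemma revp_eq0 q : revp q = 0 -> q = 0.
Proof.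
move=> /(congr1 (fun p : {poly k} => p`_0)); rewrite coef_poly coef0 subn0.
case: (posnP (size q)) => [/eqP|_ /eqP]; first by rewrite size_poly_eq0 => /eqP.
by rewrite lead_coef_eq0 => /eqP.
Qed.

Lemma line_generatorV T : line_generator T -> line_generator T^-1.
Proof.
move=> gT; have T0 := line_generator_neq0 gT; have V0 := invr_neq0 T0.
case: gT => inj gen; split=> [q|z].
  rewrite (evp_revp _ V0) invrK => /eqP; rewrite mulf_eq0 (negPf (expf_neq0 _ V0)) /=.
  by move/eqP/inj/revp_eq0.
case: (gen z) => n [d [d0 ->]].
exists (revp n * 'X^((size d).-1)), (revp d * 'X^((size n).-1)).
move: d0; rewrite !evpM !evpXn !exprVn (evp_revp _ T0) mulf_eq0 negb_or => /andP[Td d0].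
rewrite mulf_neq0 ?invr_eq0 ?expf_neq0//; split=> //.
rewrite (evp_revp _ T0); field; by rewrite d0 !expf_neq0.
Qed.

(** Localize [k[T]] at the evaluation [T |-> c]. A valuation positive at [T - c] is nonnegative on
    [k[T]], hence positive on all multiples of [T - c]; this gives uniqueness. *)
Lemma line_point T c : line_generator T ->
  exists P, [/\ P (T - i c) = 1, residually_constant P
    & forall Q, 0 < Q (T - i c) -> Q = P].
Proof.
move=> gT; have [inj gen] := gT.
pose G z a := exists2 q, z = evp T q & a = q.[c].
case: (@localization_point _ _ i G (T - i c)) => //.
- by move=> a; exists a%:P; rewrite ?evpC ?hornerC.
- by move=> _ _ _ _ [q -> ->] [q' -> ->]; exists (q + q'); rewrite ?evpD ?hornerD.
- by move=> _ _ _ _ [q -> ->] [q' -> ->]; exists (q * q'); rewrite ?evpM ?hornerM.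
- by move=> _ [q /esym/inj -> ->]; rewrite horner0.
- exact: line_generator_sub_neq0.
- by exists ('X - c%:P); rewrite ?evpXsubC ?hornerXsubC ?subrr.
- have mul q : q != 0 -> exists m q', q'.[c] != 0 /\ evp T q = (T - i c) ^+ m * evp T q'.
    move=> q0; case: (multiplicity_XsubC q c) => m [q']; rewrite q0 /= => q'c qE.
    exists m, q'; split=> //; rewrite {1}qE evpM mulrC; congr (_ * _).
    by rewrite -evpXsubC /evp rmorphXn horner_exp.
  move=> z z0; case: (gen z) => n [d [d0 zE]].
  have n0 : n != 0.
    by apply: contra_neq z0 => n0; rewrite zE n0 /evp rmorph0 horner0 mul0r.
  have d00 : d != 0 by apply: contra_neq d0 => ->; rewrite /evp rmorph0 horner0.
  case: (mul _ n0) => a [n' [n'0 nE]]; case: (mul _ d00) => b [d' [d'0 dE]].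
  exists (a%:Z - b%:Z), (evp T n'), (evp T d'), n'.[c], d'.[c]; split=> //.
  + by exists n'.
  + by exists d'.
  have Tc := line_generator_sub_neq0 c gT.
  rewrite zE nE dE expfzDr// -exprnN.
  have -> : (T - i c) ^ a%:Z = (T - i c) ^+ a by [].
  by rewrite invfM mulrACA.
move=> P [PG P1 Pres Puniq]; exists P; split=> // Q Q1; apply: Puniq => z [q -> /esym qc].
have /factor_theorem[q' ->] : root q c by apply/rootP.
rewrite evpM evpXsubC; apply/val_ge_vanishes; rewrite -(add0r 1).
apply: val_geM; last by right.
have QT : val_ge Q 0 T.
  rewrite -[T](subrK (i c)); apply: val_geD (val_ge_const _ _).
  by right; exact: ltW.
rewrite /evp; elim/poly_ind: q' => [|q' a IHq]; first by left; rewrite rmorph0 horner0.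
rewrite rmorphD rmorphM /= map_polyX map_polyC hornerMXaddC /=.
apply: val_geD (val_ge_const _ _); rewrite -(addr0 0); exact: val_geM.
Qed.

(* Over an algebraically closed field of constants, a valuation at which every
   T - c is a unit is trivial. *)
Lemma line_point_cases T Q : line_generator T ->
  Q T < 0 \/ exists c, 0 < Q (T - i c).
Proof.
move=> gT; have [inj gen] := gT.
have [QT|QT] : Q T < 0 \/ 0 <= Q T by ilia.
  by left.
right; apply: contrapT => /forallNP noc.
have Q0 c : Q (T - i c) = 0.
  have h : val_ge Q 0 (T - i c) by apply: val_geB (val_ge_const _ _); right.
  have := val_geP (line_generator_sub_neq0 c gT) h.
  by move/negP: (noc c); ilia.
have Qq q : q != 0 -> Q (evp T q) = 0.
  move=> q0; have [r qE] := closed_field_poly_normal q.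
  have lq0 : i (lead_coef q) != 0 by rewrite fmorph_eq0 lead_coef_eq0.
  rewrite qE -mul_polyC evpM evpC.
  elim: r {qE} => [|a r IHr].
    by rewrite big_nil -[1]/(1%:P) evpC rmorph1 mulr1 valuation_const// lead_coef_eq0.
  rewrite big_cons evpM evpXsubC mulrCA valuationM ?line_generator_sub_neq0//.
    by rewrite Q0 IHr.
  rewrite mulf_neq0// evp_neq0// monic_neq0// monic_prod// => b _; exact: monicXsubC.
have [u u0 Qu] := valuation_unif Q.
have := gen u => -[n [d [d0 uE]]].
have n0 : n != 0 by apply: contra_neq u0 => n0; rewrite uE n0 /evp rmorph0 horner0 mul0r.
have d00 : d != 0 by apply: contra_neq d0 => ->; rewrite /evp rmorph0 horner0.
by move: Qu; rewrite uE val_div ?evp_neq0// !Qq.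
Qed.

Lemma line_point_pole T Q : line_generator T -> Q T < 0 ->
  0 < Q (T^-1 - i 0) /\ forall c, Q (T - i c) = Q T.
Proof.
move=> gT QT; split; first by rewrite rmorph0 subr0 valV oppr_gt0.
move=> c; apply: val_addl; first exact: line_generator_neq0.
by apply/val_geN; apply: val_ge_le (val_ge_const _ _); ilia.
Qed.

Lemma line_point_infty T : line_generator T ->
  exists P, [/\ P T = -1, residually_constant P & forall Q, Q T < 0 -> Q = P].
Proof.
move=> gT; have [P [P1 Pres Pu]] := line_point 0 (line_generatorV gT).
exists P; split=> //.
  by move: P1; rewrite rmorph0 subr0 valV; ilia.
by move=> Q QT; apply: Pu; case: (line_point_pole gT QT).
Qed.

End Line.

(** * Principal divisors of degree 0 *)

Section Curve.
Variables (k K : fieldType) (i : {rmorphism k -> K}).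

Definition principal_degree0 (z : K) :=
  finite_supp (fun P : closed_point i => P z) /\
  fsum (fun P : closed_point i => P z) = 0.

(** The property carried up the tower of double covers: residues are needed to describe the next
    fibres, degrees to count zeros and poles. *)
Definition complete_curve :=
  (forall P : closed_point i, residually_constant P) /\
  (forall z, z != 0 -> principal_degree0 z).

Lemma principal_degree0M z z' : z != 0 -> z' != 0 ->
  principal_degree0 z -> principal_degree0 z' -> principal_degree0 (z * z').
Proof.
move=> z0 z'0 [fz sz] [fz' sz'].
have E : (fun P : closed_point i => P (z * z')) = (fun P => P z + P z').
  by apply/funext => P; rewrite valuationM.
rewrite /principal_degree0 E; split; first exact: finite_suppD.
by rewrite fsumD// sz sz'.
Qed.

Lemma principal_degree0V z : principal_degree0 z -> principal_degree0 z^-1.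
Proof.
have E : (fun P : closed_point i => P z^-1) = (fun P => - P z).
  by apply/funext => P; rewrite valV.
move=> [fz sz]; rewrite /principal_degree0 E; split; first exact: finite_suppN.
by rewrite fsumN sz oppr0.
Qed.

Lemma principal_degree0_const c : c != 0 -> principal_degree0 (i c).
Proof.
move=> c0; have E : (fun P : closed_point i => P (i c)) = fun=> 0.
  by apply/funext => P; rewrite valuation_const.
rewrite /principal_degree0 E; split; first exact: finite_supp0.
exact: fsum0.
Qed.

End Curve.

(** Every nonzero function is a constant times a product of factors [T - c] and their inverses, and
    the divisor of [T - c] is the point [c] minus the point at infinity. *)
Lemma line_complete (k : closedFieldType) (K : fieldType) (i : {rmorphism k -> K}) T :
  line_generator i T -> complete_curve i.
Proof.
move=> gT; have [Poo [Poo1 Poo_res Poo_u]] := line_point_infty gT.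
split=> [P|].
  case: (line_point_cases P gT) => [/Poo_u ->//|[c Pc]].
  by have [Q [_ Qres /(_ _ Pc) ->]] := line_point c gT.
have XsubC c : principal_degree0 i (T - i c).
  have [Pc [Pc1 _ Pc_u]] := line_point c gT.
  have ooc := (line_point_pole gT (_ : Poo T < 0)).2 c.
  have E : (fun P : closed_point i => P (T - i c)) =
      (fun P => (P == Pc)%:Z * 1 + (P == Poo)%:Z * -1).
    apply/funext => P; have [->|PPc] := eqVneq P Pc.
      have [Pc_oo|_] := eqVneq Pc Poo; last by rewrite Pc1 mul0r addr0.
      by move: Pc1; rewrite Pc_oo ooc Poo1.
    have [->|PPoo] := eqVneq P Poo; first by rewrite ooc Poo1.
    rewrite !mul0r addr0; case: (line_point_cases P gT) => [/Poo_u Pe|_].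
      by rewrite Pe eqxx in PPoo.
    have [h|[h|//]] : 0 < P (T - i c) \/ P (T - i c) < 0 \/ P (T - i c) = 0 by ilia.
      by rewrite (Pc_u _ h) eqxx in PPc.
    have /Poo_u Pe : P T < 0; last by rewrite Pe eqxx in PPoo.
    have [|hT] : P T < 0 \/ 0 <= P T by ilia.
      by [].
    have : val_ge P 0 (T - i c) by apply: val_geB (val_ge_const _ _); right.
    by move/(val_geP (line_generator_sub_neq0 c gT)); ilia.
  rewrite /principal_degree0 E; split.
    by apply: finite_suppD; exact: finite_supp_pt.
  rewrite fsumD.
  - by rewrite !fsum_pt.
  - exact: finite_supp_pt.
  - exact: finite_supp_pt.
have evq q : q != 0 -> principal_degree0 i (evp i T q).
  move=> q0; have [r qE] := closed_field_poly_normal q.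
  have lq0 : i (lead_coef q) != 0 by rewrite fmorph_eq0 lead_coef_eq0.
  rewrite qE -mul_polyC evpM evpC.
  elim: r {qE} => [|a r IHr].
    rewrite big_nil -[1]/(1%:P) evpC rmorph1 mulr1.
    by apply: principal_degree0_const; rewrite lead_coef_eq0.
  rewrite big_cons evpM evpXsubC mulrCA; apply: principal_degree0M => //.
    exact: line_generator_sub_neq0.
  rewrite mulf_neq0// evp_neq0// monic_neq0// monic_prod// => b _; exact: monicXsubC.
move=> z z0; have := gT.2 z => -[n [d [d0 zE]]].
have n0 : n != 0 by apply: contra_neq z0 => n0; rewrite zE n0 /evp rmorph0 horner0 mul0r.
have d00 : d != 0 by apply: contra_neq d0 => ->; rewrite /evp rmorph0 horner0.
rewrite zE; apply: principal_degree0M; rewrite ?invr_eq0 ?evp_neq0//; first exact: evq.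
by apply: principal_degree0V; exact: evq.
Qed.

(** * Restriction of points to a subfield *)

Section PointsBelow.
Variables (k K K' : fieldType) (i : {rmorphism k -> K}) (i' : {rmorphism k -> K'}).
Variable fs : {rmorphism K -> K'}.
Implicit Types (p : closed_point i) (P : closed_point i').

(** [e] is the ramification index, the value of [P] at a uniformizer of [p]; contraction of the
    local rings makes the units of [p] units at [P]. *)
Lemma maps_toP P p :
  maps_to fs P p <-> exists e, 0 < e /\ forall a, P (fs a) = e * p a.
Proof.
split=> [Pp|[e [e0 Pe]] a]; last first.
  have [->|a0] := eqVneq a 0; first by rewrite rmorph0; split; left.
  have fa0 : fs a != 0 by rewrite fmorph_eq0.
  split=> [/(val_geP a0) h|/(val_geP fa0)]; first by right; rewrite Pe mulr_ge0// ltW.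
  by rewrite Pe pmulr_rge0//; right.
have [u u0 pu] := valuation_unif p; exists (P (fs u)); split.
  have fu0 : fs u^-1 != 0 by rewrite fmorph_eq0 invr_eq0.
  have E : P (fs u^-1) = - P (fs u) by rewrite fmorphV valV.
  have [//|] : 0 < P (fs u) \/ 0 <= P (fs u^-1) by rewrite E; ilia.
  move=> h; have /Pp/(val_geP (invr_neq0 u0)) : regular_at P (fs u^-1) by right.
  by rewrite valV pu.
move=> a; have [->|a0] := eqVneq a 0; first by rewrite rmorph0 !valuation0 mulr0.
have b0 : a / u ^ p a != 0 by rewrite mulf_neq0 ?invr_eq0 ?expfz_neq0.
have pb : p (a / u ^ p a) = 0.
  by rewrite val_div ?expfz_neq0// valXz// pu mulr1 subrr.
have h1 : regular_at P (fs (a / u ^ p a)) by apply/Pp; right; rewrite pb.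
have h2 : regular_at P (fs (a / u ^ p a)^-1) by apply/Pp; right; rewrite valV pb.
have fb0 : fs (a / u ^ p a) != 0 by rewrite fmorph_eq0.
have fb0' : fs (a / u ^ p a)^-1 != 0 by rewrite fmorph_eq0 invr_eq0.
have E : P (fs (a / u ^ p a)^-1) = - P (fs (a / u ^ p a)) by rewrite fmorphV valV.
move: (val_geP fb0 h1) (val_geP fb0' h2); rewrite E => {}h1 {}h2.
have /eqP : P (fs (a / u ^ p a)) = 0 by ilia.
have -> : fs (a / u ^ p a) = fs a / fs u ^ p a by rewrite fmorph_div fmorphXz.
rewrite val_div ?expfz_neq0 ?fmorph_eq0//.
by rewrite valXz ?fmorph_eq0// subr_eq0 mulrC => /eqP.
Qed.

Lemma maps_to_inj P p q : maps_to fs P p -> maps_to fs P q -> p = q.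
Proof. by move=> Pp Pq; apply: eq_regular_point => a; rewrite Pp Pq. Qed.

Lemma maps_to_val_ge P p n a : maps_to fs P p -> 0 <= n ->
  val_ge p n a -> val_ge P n (fs a).
Proof.
move=> /maps_toP[e [e0 Pe]] n0 [->|na]; first by rewrite rmorph0; left.
right; rewrite Pe; apply: (le_trans na).
by rewrite -{1}[p a]mul1r ler_wpM2r//; exact: le_trans na.
Qed.

Lemma restricted_point P : (exists2 a, a != 0 & P (fs a) != 0) ->
  (forall c, fs (i c) = i' c) -> exists p, maps_to fs P p.
Proof.
move=> [b b0 Pb] hfs.
(* The positive values of [P] on [K], shifted by 1 to range over the natural numbers. The least one
   generates the value group, and dividing by it normalizes the restriction. *)
pose pos n := `[< exists2 a, a != 0 & P (fs a) = n.+1%:Z >].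
have exn : exists n, pos n.
  have [h|h] : 0 < P (fs b) \/ P (fs b) < 0 by move/eqP: Pb; ilia.
    by exists (absz (P (fs b) - 1)); apply/asboolP; exists b => //; lia.
  exists (absz (P (fs b) + 1)); apply/asboolP; exists b^-1; first by rewrite invr_eq0.
  have -> : P (fs b^-1) = - P (fs b) by rewrite fmorphV valV.
  by lia.
have [m /asboolP[u u0 Pu] minm] := ex_minnP exn.
pose e := m.+1%:Z.
(* Otherwise the remainder, being the value at [a / u ^ q], would be a smaller positive value. *)
have dvd a : a != 0 -> (e %| P (fs a))%Z.
  move=> a0; apply/dvdz_mod0P/eqP/negPn/negP => r0.
  pose q := (P (fs a) %/ e)%Z; pose r := (P (fs a) %% e)%Z.
  have qr : P (fs a) = q * e + r by exact: divz_eq.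
  have r_ge0 : 0 <= r by exact: modz_ge0.
  have r_lt : r < e by exact: ltz_pmod.
  have : pos (absz (r - 1)).
    apply/asboolP; exists (a / u ^ q); first by rewrite mulf_neq0 ?invr_eq0 ?expfz_neq0.
    have -> : fs (a / u ^ q) = fs a / fs u ^ q by rewrite fmorph_div fmorphXz.
    rewrite val_div ?expfz_neq0 ?fmorph_eq0//.
    by rewrite valXz ?fmorph_eq0// Pu qr -/e; move/eqP: r0; rewrite -/r; lia.
  by move/minm; rewrite -/r in r0; rewrite /e in r_lt; move/eqP: r0; lia.
pose v a := (P (fs a) %/ e)%Z.
have vE a : a != 0 -> P (fs a) = v a * e by move=> /dvd/divzK ->.
have e0 : e != 0 by [].
have v0 : v 0 = 0 by rewrite /v rmorph0 valuation0 div0z.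
have vM a a' : a != 0 -> a' != 0 -> v (a * a') = v a + v a'.
  move=> a0 a'0; apply: (mulIf e0); rewrite mulrDl -!vE ?mulf_neq0//.
  by rewrite rmorphM valuationM ?fmorph_eq0.
have vD a a' : a != 0 -> a' != 0 -> a + a' != 0 -> Num.min (v a) (v a') <= v (a + a').
  move=> a0 a'0 aa'0; have e_gt0 : 0 < e by [].
  rewrite -(ler_pM2r e_gt0) minr_pMl ?(ltW e_gt0)// -!vE// rmorphD.
  by apply: valuationD; rewrite -?rmorphD fmorph_eq0.
have vc c : c != 0 -> v (i c) = 0.
  by move=> c0; apply: (mulIf e0); rewrite -vE ?fmorph_eq0// hfs valuation_const// mul0r.
have vu : v u = 1 by apply: (mulIf e0); rewrite -vE// mul1r.
exists (ClosedPoint v0 vM vD vc (ex_intro2 _ _ u u0 vu)).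
apply/maps_toP; exists e; split=> // a /=.
have [->|a0] := eqVneq a 0; first by rewrite v0 rmorph0 valuation0 mulr0.
by rewrite vE// mulrC.
Qed.

End PointsBelow.

(** * Quadratic extensions *)

Definition quadratic_extension (K K' : fieldType) (fs : {rmorphism K -> K'})
    (w : K') (d : K) : Prop :=
  [/\ w ^+ 2 = fs d,
      forall a b, fs a + fs b * w = 0 -> a = 0 /\ b = 0
    & forall z, exists ab : K * K, z = fs ab.1 + fs ab.2 * w].

Section Quadratic.
Variables (k : closedFieldType) (K K' : fieldType).
Variables (i : {rmorphism k -> K}) (i' : {rmorphism k -> K'}).
Variable fs : {rmorphism K -> K'}.
Variables (w : K') (d : K).
Hypothesis hfs : forall c, fs (i c) = i' c.
Hypothesis quad : quadratic_extension fs w d.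
Hypothesis char2 : 2%:R != 0 :> k.
Implicit Types (p : closed_point i) (P Q : closed_point i') (a b c : K) (z : K').

Let w2 : w ^+ 2 = fs d. Proof. by case: quad. Qed.

Definition coord z : K * K := xget (0, 0) [set ab | z = fs ab.1 + fs ab.2 * w].

Lemma coordE z : z = fs (coord z).1 + fs (coord z).2 * w.
Proof.
have [_ _ gen] := quad; have [ab zE] := gen z.
exact: (@xgetPex _ (0, 0) [set ab | z = fs ab.1 + fs ab.2 * w] (ex_intro _ ab zE)).
Qed.

Lemma coord_uniq a b a' b' :
  fs a + fs b * w = fs a' + fs b' * w -> a = a' /\ b = b'.
Proof.
have [_ free _] := quad; move=> E.
have /free[/eqP + /eqP] : fs (a - a') + fs (b - b') * w = 0.
  by rewrite !rmorphB mulrBl addrACA -opprD E subrr.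
by rewrite !subr_eq0 => /eqP -> /eqP ->.
Qed.

Lemma coord_fs a b : coord (fs a + fs b * w) = (a, b).
Proof.
have /coord_uniq[aE bE] := coordE (fs a + fs b * w).
by rewrite [LHS]surjective_pairing -aE -bE.
Qed.

Definition conj z := fs (coord z).1 - fs (coord z).2 * w.

Lemma conj_coord a b : conj (fs a + fs b * w) = fs a - fs b * w.
Proof. by rewrite /conj coord_fs. Qed.

Lemma conj_fs a : conj (fs a) = fs a.
Proof. by have := conj_coord a 0; rewrite rmorph0 mul0r addr0 subr0. Qed.

Lemma conj_w : conj w = - w.
Proof. by have := conj_coord 0 1; rewrite rmorph0 rmorph1 mul1r add0r sub0r. Qed.

Lemma conjD z z' : conj (z + z') = conj z + conj z'.
Proof.
rewrite {1}(coordE z) {1}(coordE z') addrACA -mulrDl -!rmorphD conj_coord.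
by rewrite /conj !rmorphD mulrDl opprD addrACA.
Qed.

Lemma conjM z z' : conj (z * z') = conj z * conj z'.
Proof.
rewrite {1}(coordE z) {1}(coordE z').
set a := (coord z).1; set b := (coord z).2.
set a' := (coord z').1; set b' := (coord z').2.
have -> : (fs a + fs b * w) * (fs a' + fs b' * w)
    = fs (a * a' + b * b' * d) + fs (a * b' + b * a') * w.
  by rewrite !rmorphD !rmorphM -w2; ring.
by rewrite conj_coord /conj -/a -/b -/a' -/b' !rmorphD !rmorphM -w2; ring.
Qed.

Lemma conjK z : conj (conj z) = z.
Proof.
have := conj_coord (coord z).1 (- (coord z).2).
by rewrite rmorphN !mulNr opprK -coordE.
Qed.

Lemma conjN z : conj (- z) = - conj z.
Proof. by rewrite -[- z]mulN1r conjM -(rmorph1 fs) -rmorphN conj_fs rmorphN rmorph1 mulN1r. Qed.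

Lemma conjB z z' : conj (z - z') = conj z - conj z'.
Proof. by rewrite conjD conjN. Qed.

Lemma conj_const (c : k) : conj (i' c) = i' c.
Proof. by rewrite -hfs conj_fs. Qed.

Lemma conj_eq0 z : (conj z == 0) = (z == 0).
Proof.
apply/eqP/eqP => [z0|->]; last by rewrite -(rmorph0 fs) conj_fs.
by rewrite -[z]conjK z0 -(rmorph0 fs) conj_fs.
Qed.

Definition norm z := (coord z).1 ^+ 2 - (coord z).2 ^+ 2 * d.

Lemma fs_norm z : fs (norm z) = z * conj z.
Proof.
rewrite {2}(coordE z) /norm /conj rmorphB [fs (_ * d)]rmorphM !rmorphXn -w2.
ring.
Qed.

Lemma norm_coord a b : norm (fs a + fs b * w) = a ^+ 2 - b ^+ 2 * d.
Proof. by rewrite /norm coord_fs. Qed.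

Lemma norm_eq0 z : (norm z == 0) = (z == 0).
Proof. by rewrite -(fmorph_eq0 fs) fs_norm mulf_eq0 conj_eq0 orbb. Qed.

Lemma trace_fs z : z + conj z = fs (2 * (coord z).1).
Proof. rewrite {1}(coordE z) /conj rmorphM rmorph_nat; ring. Qed.

Lemma d_neq0 : d != 0.
Proof.
have [_ free _] := quad; apply/eqP => d0; move: w2.
rewrite d0 rmorph0 => /eqP; rewrite expf_eq0 /= => /eqP w0.
have /free[_ /eqP] : fs 0 + fs 1 * w = 0 by rewrite w0 mulr0 rmorph0 addr0.
by rewrite oner_eq0.
Qed.

Let w_neq0 : w != 0.
Proof.
by apply/eqP => w0; move: d_neq0; rewrite -(fmorph_eq0 fs) -w2 w0 expr0n /= eqxx.
Qed.

Section ConjPoint.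
Variable P : closed_point i'.
Let v z := P (conj z).
Let v0 : v 0 = 0. Proof. by rewrite /v -(rmorph0 fs) conj_fs rmorph0 valuation0. Qed.
Let vM z z' : z != 0 -> z' != 0 -> v (z * z') = v z + v z'.
Proof. by move=> z0 z'0; rewrite /v conjM valuationM ?conj_eq0. Qed.
Let vD z z' : z != 0 -> z' != 0 -> z + z' != 0 ->
  Num.min (v z) (v z') <= v (z + z').
Proof.
by move=> z0 z'0 zz'0; rewrite /v conjD valuationD -?conjD ?conj_eq0.
Qed.
Let vc (c : k) : c != 0 -> v (i' c) = 0.
Proof. by move=> c0; rewrite /v conj_const valuation_const. Qed.
Let vu : exists2 z, z != 0 & v z = 1.
Proof.
have [u u0 Pu] := valuation_unif P.
by exists (conj u); [rewrite conj_eq0|rewrite /v conjK].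
Qed.
Definition conj_point := ClosedPoint v0 vM vD vc vu.
Lemma conj_pointE z : conj_point z = P (conj z). Proof. by []. Qed.
End ConjPoint.

Lemma conj_pointK P : conj_point (conj_point P) = P.
Proof. by apply: closed_point_eq => z z0; rewrite !conj_pointE conjK. Qed.

Lemma maps_to_conj P p : maps_to fs P p -> maps_to fs (conj_point P) p.
Proof.
move=> /maps_toP[e [e0 Pe]]; apply/maps_toP; exists e; split=> // a.
by rewrite conj_pointE conj_fs.
Qed.

Lemma conj_point_has_val P z (c : k) : has_val P (conj z) c -> has_val (conj_point P) z c.
Proof.
rewrite /has_val => -[/eqP h|h]; [left; apply/eqP|right].
  by rewrite -conj_eq0 conjB conj_const.
by rewrite conj_pointE conjB conj_const.
Qed.

Lemma conj_point_residually_constant P :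
  residually_constant P -> residually_constant (conj_point P).
Proof.
move=> res z zP; have [|c zc] := res (conj z); last first.
  by exists c; exact: conj_point_has_val.
by case: zP => [->|zP]; [left; rewrite -(rmorph0 fs) conj_fs|right].
Qed.

(** [P] cannot be trivial on [K]: for a uniformizer [u], the equation [N(u) = tr(u) u - u^2] would
    give the nonzero element [N(u)] of [K] positive order. *)
Lemma maps_to_exists P : exists p, maps_to fs P p.
Proof.
apply: (@restricted_point _ _ _ i i' fs P) => //; apply: contrapT => triv.
have fs0 a : a != 0 -> P (fs a) = 0.
  by move=> a0; apply/eqP/negPn/negP => Pa; apply: triv; exists a.
have ge0 a : val_ge P 0 (fs a).
  have [->|a0] := eqVneq a 0; first by left; rewrite rmorph0.
  by right; rewrite fs0.
have [u u0 Pu] := valuation_unif P.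
have nu0 : norm u != 0 by rewrite norm_eq0.
have : val_ge P 1 (fs (norm u)).
  have -> : fs (norm u) = fs (2 * (coord u).1) * u - u * u.
    by rewrite fs_norm -trace_fs; ring.
  have u1 : val_ge P 1 u by right; rewrite Pu.
  apply: val_geB; first exact: (@val_geM _ _ _ _ 0 1).
  by apply: (@val_ge_le _ _ _ _ (1 + 1)) => //; exact: val_geM.
by move/val_geP; rewrite fmorph_eq0 => /(_ nu0); rewrite fs0.
Qed.

Section Fibre.
Variable p : closed_point i.
Hypothesis res : residually_constant p.

Let regular_fs Q a n : maps_to fs Q p -> 0 <= n -> val_ge p n a -> val_ge Q n (fs a).
Proof. exact: maps_to_val_ge. Qed.

Lemma unit_has_val a : a != 0 -> p a = 0 -> exists2 v, has_val p a v & v != 0.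
Proof.
move=> a0 pa; have [|v av] := res (z := a); first by right; rewrite pa.
by exists v => //; exact: has_val_neq0 av.
Qed.

Lemma maps_to_unif P u e : u != 0 -> p u = 1 -> P (fs u) = e -> 0 < e ->
  (forall a v, has_val p a v -> has_val P (fs a) v) ->
  forall a, P (fs a) = e * p a.
Proof.
move=> u0 pu Pu e0 PG a.
have [->|a0] := eqVneq a 0; first by rewrite rmorph0 !valuation0 mulr0.
have upa : u ^ p a != 0 by rewrite expfz_neq0.
have b0 : a / u ^ p a != 0 by rewrite mulf_neq0 ?invr_eq0.
have pb : p (a / u ^ p a) = 0 by rewrite val_div// valXz// pu mulr1 subrr.
have [v /PG bv v0] := unit_has_val b0 pb.
have [_ Pb] := has_val_unit bv v0.
have fE : fs a = fs (a / u ^ p a) * fs u ^ p a by rewrite -fmorphXz -rmorphM divfK.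
rewrite fE valuationM ?expfz_neq0 ?fmorph_eq0//.
by rewrite Pb valXz ?fmorph_eq0// Pu add0r mulrC.
Qed.

Lemma sqr_scale c : (fs c * w) ^+ 2 = fs (c ^+ 2 * d).
Proof. by rewrite exprMn w2 rmorphM rmorphXn. Qed.

Lemma gen_scale c z : c != 0 -> exists a b, z = fs a + fs b * (fs c * w).
Proof.
move=> c0; exists (coord z).1, ((coord z).2 / c).
by rewrite mulrA -rmorphM divfK// -coordE.
Qed.

Lemma free_scale c a b : c != 0 -> fs a + fs b * (fs c * w) = 0 -> a = 0 /\ b = 0.
Proof.
have [_ free _] := quad; move=> c0; rewrite mulrA -rmorphM => /free[-> /eqP].
by rewrite mulf_eq0 (negPf c0) orbF => /eqP ->.
Qed.

(** Rescaling makes [w0 ^+ 2] a uniformizer at [p]. As for an Eisenstein polynomial, [w0] is then a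
    uniformizer at the only point above [p], and the residue of [a + b w0] is that of [a]. *)
Lemma ramified_fibre m : p d = m * 2 + 1 ->
  exists P, [/\ forall Q, maps_to fs Q p <-> Q = P, forall a, P (fs a) = 2 * p a
    & residually_constant P].
Proof.
move=> pd; have [u u0 pu] := valuation_unif p.
pose c := u ^ (- m); have c0 : c != 0 by rewrite expfz_neq0.
pose d0 := c ^+ 2 * d; have d00 : d0 != 0 by rewrite mulf_neq0 ?expf_neq0 ?d_neq0.
have pd0 : p d0 = 1.
  rewrite valuationM ?expf_neq0 ?d_neq0// valX// valXz// pu pd; ring.
pose w0 := fs c * w; have w02 : w0 ^+ 2 = fs d0 by exact: sqr_scale.
have w00 : w0 != 0 by rewrite mulf_neq0 ?fmorph_eq0.
clearbody d0.
pose G z v := exists a b, [/\ has_val p a v, val_ge p 0 b & z = fs a + fs b * w0].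
have G_fs a v : has_val p a v -> G (fs a) v.
  by move=> av; exists a, 0; split=> //; [left|rewrite rmorph0 mul0r addr0].
have claim a b : a != 0 -> val_ge p (p a) b -> exists n x s cx cs,
   [/\ G x cx, G s cs, cx != 0, cs != 0 & fs a + fs b * w0 = w0 ^ n * (x / s)].
  move=> a0 ab; pose e := d0 ^ p a.
  have e0 : e != 0 by rewrite expfz_neq0.
  have pe : p e = p a by rewrite valXz// pd0 mulr1.
  have [||v av v0] := @unit_has_val (a / e).
  - by rewrite mulf_neq0 ?invr_eq0.
  - by rewrite val_div// pe subrr.
  exists (2 * p a), (fs (a / e) + fs (b / e) * w0), 1, v, 1; split=> //.
  - exists (a / e), (b / e); split=> //.
    by apply: (@val_ge_div _ _ _ _ 0 (p a)); rewrite ?pe// add0r.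
  - by rewrite -(rmorph1 fs); apply: G_fs; rewrite -(rmorph1 i); exact: has_val_const.
  - exact: oner_neq0.
  have -> : w0 ^ (2 * p a) = fs e by rewrite -exprz_exp fmorphXz -w02.
  rewrite divr1 !fmorph_div; field; by rewrite fmorph_eq0.
case: (@localization_point _ _ i' G w0) => //.
- by move=> v; rewrite -hfs; apply: G_fs; exact: has_val_const.
- move=> _ _ v v' [a [b [av b0 ->]]] [a' [b' [av' b'0 ->]]].
  exists (a + a'), (b + b'); split; [exact: has_valD|exact: val_geD|].
  by rewrite !rmorphD; ring.
- move=> _ _ v v' [a [b [av b0 ->]]] [a' [b' [av' b'0 ->]]].
  exists (a * a' + b * b' * d0), (a * b' + b * a'); split.
  + rewrite -[v * v']addr0; apply: has_valD; first exact: has_valM.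
    apply/has_val0E; apply: (@val_geM _ _ _ _ 0 1); last by right; rewrite pd0.
    exact: (@val_geM _ _ _ _ 0 0).
  + apply: val_geD; first exact: (@val_geM _ _ _ _ 0 0 _ _ (has_val_regular av)).
    exact: (@val_geM _ _ _ _ 0 0 _ _ b0 (has_val_regular av')).
  + by rewrite !rmorphD !rmorphM -w02; ring.
- move=> v [a [b [av b0 /esym/(free_scale c0)[a0 _]]]].
  by apply: (has_val_inj av); rewrite a0 -(rmorph0 i); exact: has_val_const.
- exists 0, 1; split; [by apply/has_val0E; left| |by rewrite rmorph0 rmorph1 mul1r add0r].
  by right; rewrite val1.
- move=> z z0; have [a [b zE]] := gen_scale z c0; rewrite zE -/w0.
  have [[a0 ab]|[b0 ab]] : (a != 0 /\ val_ge p (p a) b) \/ (b != 0 /\ val_ge p (p b + 1) a).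
    have [a0|a0] := eqVneq a 0.
      right; split; last by left.
      by apply: contra_neq z0 => b0; rewrite zE a0 b0 !rmorph0 mul0r addr0.
    have [b0|b0] := eqVneq b 0; first by left; split=> //; left.
    have [h|h] : p a <= p b \/ p b + 1 <= p a by ilia.
      by left; split=> //; right.
    by right; split=> //; right.
  + exact: claim.
  (* When [b] dominates, one factor [w0] comes out: [a + b w0 = w0 (b + (a / d0) w0)], and the
     previous case applies. *)
  have [|n [x [s [cx [cs [Gx Gs cx0 cs0 E]]]]]] := claim b (a / d0) b0.
    by apply: (@val_ge_div _ _ _ _ _ 1) => //; rewrite pd0.
  exists (1 + n), x, s, cx, cs; split=> //.
  rewrite expfzDr// expr1z -mulrA -E mulrDr addrC mulrC; congr (_ + _).
  by rewrite mulrCA -expr2 w02 -rmorphM divfK.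
move=> P [PG Pw0 Pres Puniq].
have Pfs : forall a, P (fs a) = 2 * p a.
  apply: (maps_to_unif d00 pd0) => // [|a v av]; last by apply: PG; exact: G_fs.
  by rewrite -w02 valX// Pw0.
have Pp : maps_to fs P p by apply/maps_toP; exists 2.
exists P; split=> // Q; split=> [Qp|->//]; apply: Puniq => _ [a [b [av b0 ->]]].
apply/val_ge_vanishes; apply: val_geD; first by apply: regular_fs => //; exact/has_val0E.
rewrite -(add0r 1); apply: val_geM; first exact: regular_fs.
right; have := @regular_fs Q d0 1 Qp isT (or_intror _).
rewrite pd0 => /(_ isT)/val_geP; rewrite fmorph_eq0 => /(_ d00).
by rewrite -w02 valX//; ilia.
Qed.

(* The residue of c^2 d at p is r^2; each root r gives the point above p at which
   c w takes the value r. *)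
Lemma split_point c r : c != 0 -> r != 0 -> has_val p (c ^+ 2 * d) (r ^+ 2) ->
  exists P, [/\ forall a, P (fs a) = p a, has_val P (fs c * w) r,
    residually_constant P
  & forall Q, maps_to fs Q p -> has_val Q (fs c * w) r -> Q = P].
Proof.
move=> c0 r0 dr; have [u u0 pu] := valuation_unif p.
pose d0 := c ^+ 2 * d; pose w0 := fs c * w.
have w02 : w0 ^+ 2 = fs d0 by exact: sqr_scale.
rewrite -/d0 in dr; clearbody d0.
pose G z v := exists a b va vb,
  [/\ has_val p a va, has_val p b vb, z = fs a + fs b * w0 & v = va + r * vb].
have hv0 : has_val p 0 0 by apply/has_val0E; left.
have hv1 : has_val p 1 1 by rewrite -(rmorph1 i); exact: has_val_const.
have G_fs a v : has_val p a v -> G (fs a) v.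
  move=> av; exists a, 0, v, 0; split=> //; last by rewrite mulr0 addr0.
  by rewrite rmorph0 mul0r addr0.
have claim a b va vb : has_val p a va -> has_val p b vb ->
    ~ (va = 0 /\ vb = 0) -> fs a + fs b * w0 != 0 -> exists n x s cx cs,
   [/\ G x cx, G s cs, cx != 0, cs != 0 & fs a + fs b * w0 = fs u ^ n * (x / s)].
  move=> av bv nz z0; have [e0|e0] := eqVneq (va + r * vb) 0; last first.
    exists 0, (fs a + fs b * w0), 1, (va + r * vb), 1; split=> //.
    - by exists a, b, va, vb.
    - by rewrite -(rmorph1 fs); exact: G_fs.
    - exact: oner_neq0.
    - by rewrite expr0z divr1 mul1r.
  have e'0 : va + r * (- vb) != 0.
    apply/negP => /eqP e'0; apply: nz.
    have /eqP : 2%:R * va = 0 by rewrite -[RHS]addr0 -{1}e0 -e'0; ring.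
    rewrite mulf_eq0 (negPf char2) /= => /eqP va0; split=> //.
    by move/eqP: e0; rewrite va0 add0r mulf_eq0 (negPf r0) /= => /eqP.
  pose n := a ^+ 2 - b ^+ 2 * d0; pose z' := fs a + fs (- b) * w0.
  have Gz' : G z' (va + r * (- vb)) by exists a, (- b), va, (- vb); split=> //; exact: has_valN.
  have zz' : (fs a + fs b * w0) * z' = fs n.
    by rewrite /z' /n rmorphN rmorphB !rmorphM -w02; ring.
  have z'0 : z' != 0.
    apply: contra_neq z0 => /(free_scale c0)[-> /eqP]; rewrite oppr_eq0 => /eqP ->.
    by rewrite !rmorph0 mul0r addr0.
  have n0 : n != 0 by rewrite -(fmorph_eq0 fs) -zz' mulf_neq0.
  have upn : u ^ p n != 0 by rewrite expfz_neq0.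
  have [||v nv v0] := @unit_has_val (n / u ^ p n).
  - by rewrite mulf_neq0 ?invr_eq0.
  - by rewrite val_div// valXz// pu mulr1 subrr.
  exists (p n), (fs (n / u ^ p n)), z', v, (va + r * (- vb)); split=> //.
    exact: G_fs.
  have -> : fs (n / u ^ p n) = fs n / fs u ^ p n by rewrite fmorph_div fmorphXz.
  have cancel (A x y : K') : A != 0 -> y != 0 -> x = A * (x * y / A / y).
    by move=> A0 y0; field; rewrite A0 y0.
  by rewrite -zz' -cancel// expfz_neq0// fmorph_eq0.
case: (@localization_point _ _ i' G (fs u)) => //.
- by move=> v; rewrite -hfs; apply: G_fs; exact: has_val_const.
- move=> _ _ _ _ [a [b [va [vb [av bv -> ->]]]]] [a' [b' [va' [vb' [av' bv' -> ->]]]]].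
  exists (a + a'), (b + b'), (va + va'), (vb + vb'); split; try exact: has_valD.
    by rewrite !rmorphD; ring.
  by ring.
- move=> _ _ _ _ [a [b [va [vb [av bv -> ->]]]]] [a' [b' [va' [vb' [av' bv' -> ->]]]]].
  exists (a * a' + b * b' * d0), (a * b' + b * a').
  exists (va * va' + vb * vb' * r ^+ 2), (va * vb' + vb * va'); split.
  + by apply: has_valD; first exact: has_valM; apply: has_valM => //; exact: has_valM.
  + by apply: has_valD; exact: has_valM.
  + by rewrite !rmorphD !rmorphM -w02; ring.
  + by ring.
- move=> v [a [b [va [vb [av bv /esym/(free_scale c0)[a0 b0] ->]]]]].
  move: av bv; rewrite a0 b0 => /(has_val_inj hv0) <- /(has_val_inj hv0) <-.
  by rewrite mulr0 addr0.
- by rewrite fmorph_eq0.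
- by apply: G_fs; apply/has_val0E; right; rewrite pu.
- move=> z z0; have [a [b zE]] := gen_scale z c0; rewrite zE -/w0.
  have scale n a' b' va vb : a = u ^ n * a' -> b = u ^ n * b' ->
      has_val p a' va -> has_val p b' vb -> ~ (va = 0 /\ vb = 0) ->
      exists n x s cx cs,
   [/\ G x cx, G s cs, cx != 0, cs != 0 & fs a + fs b * w0 = fs u ^ n * (x / s)].
    move=> aE bE av bv nz.
    have E : fs a + fs b * w0 = fs u ^ n * (fs a' + fs b' * w0).
      by rewrite aE bE !rmorphM -fmorphXz; ring.
    have z'0 : fs a' + fs b' * w0 != 0.
      by apply: contra_neq z0 => z'0; rewrite zE -/w0 E z'0 mulr0.
    have [m [x [s [cx [cs [Gx Gs cx0 cs0 mE]]]]]] := claim _ _ _ _ av bv nz z'0.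
    exists (n + m), x, s, cx, cs; split=> //.
    by rewrite expfzDr ?fmorph_eq0// -mulrA -mE.
  (* Division by the power of [u] of least order leaves residues that are not both 0, as [claim]
     requires. *)
  have unitize a' b' : a' != 0 -> val_ge p (p a') b' ->
      exists va vb, [/\ has_val p (a' / u ^ p a') va, has_val p (b' / u ^ p a') vb & va != 0].
    move=> a0 ab; have upa : u ^ p a' != 0 by rewrite expfz_neq0.
    have pupa : p (u ^ p a') = p a' by rewrite valXz// pu mulr1.
    have [||va av va0] := @unit_has_val (a' / u ^ p a').
    - by rewrite mulf_neq0 ?invr_eq0.
    - by rewrite val_div// pupa subrr.
    have [|vb bv] := res (z := b' / u ^ p a').
      by apply: (@val_ge_div _ _ _ _ 0 (p a')); rewrite ?pupa// add0r.
    by exists va, vb.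
  have div n a' : a' = u ^ n * (a' / u ^ n) by rewrite mulrC divfK// expfz_neq0.
  have [[a0 ab]|[b0 ab]] : (a != 0 /\ val_ge p (p a) b) \/ (b != 0 /\ val_ge p (p b) a).
    have [a0|a0] := eqVneq a 0.
      right; split; last by left.
      by apply: contra_neq z0 => b0; rewrite zE a0 b0 !rmorph0 mul0r addr0.
    have [b0|b0] := eqVneq b 0; first by left; split=> //; left.
    have [h|h] : p a <= p b \/ p b <= p a by ilia.
      by left; split=> //; right.
    by right; split=> //; right.
  + have [va [vb [av bv va0]]] := unitize _ _ a0 ab.
    apply: (scale (p a) _ _ va vb (div _ a) (div _ b)) => //.
    by case=> va00; rewrite va00 eqxx in va0.
  have [vb [va [bv av vb0]]] := unitize _ _ b0 ab.
  apply: (scale (p b) _ _ va vb (div _ a) (div _ b)) => //.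
  by case=> _ vb00; rewrite vb00 eqxx in vb0.
move=> P [PG Pu Pres Puniq]; exists P; split=> //.
- move=> a; rewrite (maps_to_unif u0 pu Pu)// ?mul1r// => b v bv.
  by apply: PG; exact: G_fs.
- by apply: PG; exists 0, 1, 0, 1; split=> //; rewrite ?rmorph0 ?rmorph1 ?mul1r ?add0r ?mulr1.
move=> Q Qp Qw; apply: Puniq => _ [a [b [va [vb [av bv -> vE]]]]].
apply/val_ge_vanishes.
have -> : fs a + fs b * w0 =
    fs (a - i va) + (fs (b - i vb) * w0 + i' vb * (w0 - i' r)).
  rewrite !rmorphB !hfs.
  have -> : i' va = - (i' r * i' vb).
    by rewrite -rmorphM -rmorphN; congr (i' _); apply/eqP; rewrite -addr_eq0 vE.
  by ring.
have w0_ge0 : val_ge Q 0 w0 by exact: has_val_regular Qw.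
apply: val_geD; first exact: regular_fs.
apply: val_geD; first by apply: (@val_geM _ _ _ _ 1 0) => //; exact: regular_fs.
exact: (@val_geM _ _ _ _ 0 1 _ _ (val_ge_const _ _)).
Qed.

Lemma closed_sqrt (v : k) : exists r, r ^+ 2 = v.
Proof.
have /closed_rootP[r /rootP] : size ('X^2 - v%:P : {poly k}) != 1%N.
  by rewrite size_XnsubC.
by rewrite hornerD hornerN hornerC hornerXn => /eqP; rewrite subr_eq0 => /eqP; exists r.
Qed.

(** The square roots [r] and [- r] of the residue of the rescaled [d] give the two points. The
    element [u], of order 1 at one and 0 at the other, lets the orders at both be prescribed
    independently. *)
Lemma split_fibre m : p d = m * 2 ->
  exists P, [/\ P <> conj_point P,
    forall Q, maps_to fs Q p <-> Q = P \/ Q = conj_point P,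
    forall a, P (fs a) = p a, residually_constant P
  & exists u, [/\ u != 0, P u = 1 & P (conj u) = 0]].
Proof.
move=> pd; have [u u0 pu] := valuation_unif p.
pose c := u ^ (- m); have c0 : c != 0 by rewrite expfz_neq0.
pose d0 := c ^+ 2 * d; have d00 : d0 != 0 by rewrite mulf_neq0 ?expf_neq0 ?d_neq0.
have pd0 : p d0 = 0.
  rewrite valuationM ?expf_neq0 ?d_neq0// valX// valXz// pu pd; ring.
pose w0 := fs c * w; have w02 : w0 ^+ 2 = fs d0 by exact: sqr_scale.
have [v dv v0] := unit_has_val d00 pd0.
have [r rv] := closed_sqrt v.
have r0 : r != 0 by apply: contra_neq v0 => r0; rewrite -rv r0 expr0n.
have [|P [Pfs Pw Pres Puniq]] := split_point c0 r0; first by rewrite rv.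
rewrite -/w0 in Pw Puniq.
have cw0 : conj w0 = - w0 by rewrite conjM conj_fs conj_w mulrN.
have Pp : maps_to fs P p by apply/maps_toP; exists 1; split=> // a; rewrite mul1r.
have r2 : - r - r != 0.
  by rewrite -opprD oppr_eq0 -mulr2n -mulr_natl mulf_neq0.
have cPw : has_val (conj_point P) w0 (- r).
  by apply: conj_point_has_val; rewrite cw0; exact: has_valN.
exists P; split=> //.
- move=> PcP; move: cPw; rewrite -PcP => /(has_val_inj Pw)/eqP.
  by rewrite eq_sym -subr_eq0 (negPf r2).
- move=> Q; split=> [Qp|[->//|->]]; last exact: maps_to_conj.
  (* [w0 ^+ 2 - r ^+ 2] vanishes at every point above [p], hence so does [w0 - r] or [w0 + r]. *)
  have Qd0 : val_ge Q 1 ((w0 - i' r) * (w0 - i' (- r))).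
    have -> : (w0 - i' r) * (w0 - i' (- r)) = fs (d0 - i v).
      by rewrite rmorphB hfs -w02 -rv rmorphXn rmorphN; ring.
    exact: regular_fs.
  have Qw0 : val_ge Q 0 w0.
    have : val_ge Q 0 (fs d0) by apply: regular_fs => //; right; rewrite pd0.
    move/val_geP; rewrite fmorph_eq0 => /(_ d00) => h; right; move: h.
    by rewrite -w02 valX ?mulf_neq0 ?fmorph_eq0//; ilia.
  have [h|h] : val_ge Q 1 (w0 - i' r) \/ val_ge Q 1 (w0 - i' (- r)).
    have [->|a0] := eqVneq (w0 - i' r) 0; first by left; left.
    have [->|b0] := eqVneq (w0 - i' (- r)) 0; first by right; left.
    have := val_geP (mulf_neq0 a0 b0) Qd0; rewrite valuationM//.
    have := val_geP a0 (val_geB Qw0 (val_ge_const Q r)).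
    have := val_geP b0 (val_geB Qw0 (val_ge_const Q (- r))).
    move=> h1 h2 h3.
    have [h|h] : 1 <= Q (w0 - i' r) \/ 1 <= Q (w0 - i' (- r)) by ilia.
      by left; right.
    by right; right.
  + by left; exact: Puniq.
  right; rewrite -[Q]conj_pointK; congr conj_point; apply: Puniq.
    exact: maps_to_conj.
  apply: conj_point_has_val; rewrite cw0 -[r in has_val _ _ r]opprK.
  exact: has_valN.
have w0r : w0 - i' r != 0.
  apply/negP => /eqP E.
  have /(free_scale c0)[_ /eqP] : fs (- i r) + fs 1 * w0 = 0.
    by rewrite rmorphN hfs rmorph1 mul1r addrC.
  by rewrite oner_eq0.
have Pw1 := val_geP w0r (Pw : val_ge P 1 _).
have cu : has_val P (conj (w0 - i' r)) (- r - r).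
  by rewrite conjB cw0 conj_const; apply: has_valB (has_val_const _ _); exact: has_valN.
(* If [w0 - r] vanishes to order at least 2, adding a uniformizer of [p] brings the order down to 1
   and does not change the residue [- 2 r] of the conjugate. *)
have [h|h] : P (w0 - i' r) = 1 \/ 1 + 1 <= P (w0 - i' r) by ilia.
  by exists (w0 - i' r); split=> //; case: (has_val_unit cu r2).
have Pu : P (fs u) = 1 by rewrite Pfs.
have fu0 : fs u != 0 by rewrite fmorph_eq0.
have Pu' : P (fs u + (w0 - i' r)) = 1.
  by rewrite val_addl// Pu; right.
exists (fs u + (w0 - i' r)); split=> //.
  by apply/eqP => E; rewrite E valuation0 in Pu'.
have cu' : has_val P (conj (fs u + (w0 - i' r))) (0 + (- r - r)).
  rewrite conjD conj_fs; apply: has_valD cu.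
  by apply/has_val0E; right; rewrite Pu.
by rewrite add0r in cu'; case: (has_val_unit cu' r2).
Qed.

End Fibre.
End Quadratic.

(** * Fibres of a double cover and pushforward of divisors *)

Section QuadraticCover.
Variables (k : closedFieldType) (K K' : fieldType).
Variables (i : {rmorphism k -> K}) (i' : {rmorphism k -> K'}).
Variable fs : {rmorphism K -> K'}.
Variables (w : K') (d : K).
Hypothesis hfs : forall c, fs (i c) = i' c.
Hypothesis quad : quadratic_extension fs w d.
Hypothesis char2 : 2%:R != 0 :> k.
Hypothesis curve : complete_curve i.
Implicit Types (p : closed_point i) (P Q : closed_point i') (a b : K) (z : K').

Local Notation sg := (conj_point hfs quad).
Local Notation nm := (norm fs w d).

Lemma fibre_exists p : exists P, [/\ forall Q, maps_to fs Q p <-> Q = P \/ Q = sg P,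
   residually_constant P,
   (exists m, p d = m * 2 + 1) /\ P = sg P /\ (forall a, P (fs a) = 2 * p a) \/
   (exists m, p d = m * 2) /\ P <> sg P /\ (forall a, P (fs a) = p a)
 & forall m n, (P = sg P -> m = n) -> exists z, [/\ z != 0, P z = m & sg P z = n]].
Proof.
have res := curve.1 p.
have [[m pd]|[m pd]] : (exists m, p d = m * 2 + 1) \/ (exists m, p d = m * 2).
- have := divz_eq (p d) 2; have := modz_ge0 (p d) (isT : (2 : int) != 0).
  have := ltz_pmod (p d) (isT : (0 : int) < 2) => h1 h2 h3.
  have [h|h] : (p d %% 2)%Z = 1 \/ (p d %% 2)%Z = 0 by ilia.
    by left; exists (p d %/ 2)%Z; rewrite {1}h3 h.
  by right; exists (p d %/ 2)%Z; rewrite {1}h3 h addr0.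
- have [P [PE Pfs Pres]] := ramified_fibre hfs quad char2 res pd.
  have PP : P = sg P by apply/esym/PE; apply: maps_to_conj; exact/PE.
  exists P; split=> //.
  + by move=> Q; rewrite PE -PP; split=> [->|[]//]; left.
  + by left; split; [exists m|].
  move=> n n' /(_ PP) <-; have [u u0 Pu] := valuation_unif P.
  exists (u ^ n); rewrite expfz_neq0//; split=> //; last rewrite -PP.
    by rewrite valXz// Pu mulr1.
  by rewrite valXz// Pu mulr1.
have [P [PP PE Pfs Pres [u [u0 Pu Pcu]]]] := split_fibre hfs quad char2 res pd.
exists P; split=> //; first by right; split; [exists m|].
move=> n n' _; have cu0 : conj fs w u != 0 by rewrite (conj_eq0 quad).
exists (u ^ n * conj fs w u ^ n'); split.
- by rewrite mulf_neq0// expfz_neq0.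
- by rewrite valuationM ?expfz_neq0// !valXz// Pu Pcu mulr0 mulr1 addr0.
rewrite valuationM ?expfz_neq0// !valXz// !conj_pointE (conjK quad) Pu Pcu.
by rewrite mulr0 mulr1 add0r.
Qed.

(** One chosen point of the fibre; the other is its conjugate, which coincides with it exactly in
    the ramified case. *)
Definition above p := projT1 (cid (fibre_exists p)).
Definition below P := projT1 (cid (maps_to_exists hfs quad P)).

Lemma maps_to_below P p : maps_to fs P p <-> below P = p.
Proof.
have h := projT2 (cid (maps_to_exists hfs quad P)).
by split=> [/(maps_to_inj h)|<-].
Qed.

Lemma below_above P p : below P = p <-> P = above p \/ P = sg (above p).
Proof.
rewrite -maps_to_below; rewrite /above; case: (cid _) => A [/= AE _ _ _]; exact: AE.
Qed.

Lemma below_conj P : below (sg P) = below P.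
Proof. by apply/maps_to_below; apply: maps_to_conj; exact/maps_to_below. Qed.

Lemma above_residually_constant p : residually_constant (above p).
Proof. by rewrite /above; case: (cid _) => A []. Qed.

Variant above_spec p : bool -> Prop :=
| AboveRamified m of p d = m * 2 + 1 & above p = sg (above p)
    & (forall P, below P = p -> P = above p)
    & (forall P a, below P = p -> P (fs a) = 2 * p a) : above_spec p true
| AboveSplit m of p d = m * 2 & above p <> sg (above p)
    & (forall P, below P = p -> P <> sg P)
    & (forall P a, below P = p -> P (fs a) = p a) : above_spec p false.

Lemma aboveP p : above_spec p (above p == sg (above p)).
Proof.
have bE P := below_above P p; move: bE.
have : (exists m, p d = m * 2 + 1) /\ above p = sg (above p) /\
    (forall a, above p (fs a) = 2 * p a) \/
   (exists m, p d = m * 2) /\ above p <> sg (above p) /\ (forall a, above p (fs a) = p a).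
  by rewrite /above; case: (cid _) => A [].
move=> [[[m pd] [AA Afs]]|[[m pd] [AA Afs]]] bE.
  have bA P : below P = p -> P = above p by move=> /bE[//|->]; rewrite -AA.
  rewrite {1}AA eqxx; apply: AboveRamified pd _ _ _ => // P a /bA ->; exact: Afs.
have /negPf -> : above p != sg (above p) by apply/eqP.
apply: AboveSplit pd _ _ _ => // [P /bE[->//|->]|P a /bE[->//|->]].
  by rewrite conj_pointK => /esym.
by rewrite conj_pointE (conj_fs quad) Afs.
Qed.

Lemma above_approx p m n : (above p = sg (above p) -> m = n) ->
  exists z, [/\ z != 0, above p z = m & sg (above p) z = n].
Proof. by rewrite /above; case: (cid _) => A [/= _ _ _]; exact. Qed.

(** The pushforward of divisors; a ramified point is counted once, all residue fields being [k]. *)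
Definition fibre_sum (F : closed_point i' -> int) p :=
  if above p == sg (above p) then F (above p) else F (above p) + F (sg (above p)).

Lemma fsum_fibre_sum F : finite_supp F ->
  finite_supp (fibre_sum F) /\ fsum F = fsum (fibre_sum F).
Proof.
move=> fF; apply: (fsum_fibres (pi := below)) => // p; rewrite /fibre_sum.
case: ifPn => AA.
  exists [:: above p]; rewrite big_seq1; split=> // P; rewrite inE.
  apply/eqP/eqP => [PA|/below_above[//|->]]; last by rewrite -(eqP AA).
  by apply/below_above; left.
exists [:: above p; sg (above p)]; split.
- by rewrite /= inE AA.
- move=> P; rewrite !inE; apply/orP/eqP => [[]/eqP h|/below_above[]->].
  + by apply/below_above; left.
  + by apply/below_above; right.
  + by left.
  + by right.
by rewrite big_cons big_seq1.
Qed.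

(** The pushforward of the divisor of [z] is the divisor of its norm:
    [P (fs (nm z)) = P z + sg P z], and at a ramified point both sides are doubled. *)
Lemma fibre_sum_val p z : z != 0 -> fibre_sum (fun P => P z) p = p (nm z).
Proof.
move=> z0; have bA : below (above p) = p by apply/below_above; left.
have nE : above p (fs (nm z)) = above p z + sg (above p) z.
  by rewrite (fs_norm quad) valuationM ?(conj_eq0 quad).
rewrite /fibre_sum; case: aboveP nE => [m pd <- _ ->//|m pd _ _ ->//]; ilia.
Qed.

(** Pullback followed by pushforward is multiplication by 2. The function [f p] may vary with [p],
    because it will be the local equation of a divisor. *)
Lemma fibre_sum_fs p (f : closed_point i -> K) :
  fibre_sum (fun P => P (fs (f (below P)))) p = 2 * p (f p).
Proof.
have bA : below (above p) = p by apply/below_above; left.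
have bA' : below (sg (above p)) = p by rewrite below_conj.
rewrite /fibre_sum bA bA'; case: aboveP => [m pd _ _ ->//|m pd _ _ h].
by rewrite !h//; ilia.
Qed.

(** Off the supports of the half trace [a] and of the norm, [z] and its conjugate have opposite
    orders and a regular sum; a nonzero order would give this sum a pole. *)
Lemma cover_finite_supp z : z != 0 -> finite_supp (fun P : closed_point i' => P z).
Proof.
move=> z0; have nz0 : nm z != 0 by rewrite (norm_eq0 quad).
pose a := (coord fs w z).1.
have fa : finite_supp (fun p : closed_point i => p a).
  have [->|a0] := eqVneq a 0; last by case: (curve.2 _ a0).
  by apply: finite_supp_sub (@finite_supp0 _) => p _; exact: valuation0.
have fn : finite_supp (fun p : closed_point i => p (nm z)) by case: (curve.2 _ nz0).
set S := [set p : closed_point i | p a <> 0] `|` [set p : closed_point i | p (nm z) <> 0].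
have fS : finite_set S by rewrite finite_setU.
have fU : finite_set ((above @` S) `|` ((fun p => sg (above p)) @` S)).
  by rewrite finite_setU; split; exact: finite_image.
apply: sub_finite_set fU => P /= Pz; pose p := below P.
have hS : S (below P).
  apply: contrapT => /not_orP[/contrapT pa /contrapT pn]; apply: Pz.
  have /maps_toP[e [e0 Pe]] : maps_to fs P (below P) by apply/maps_to_below.
  have Ptr : val_ge P 0 (z + conj fs w z).
    rewrite (trace_fs quad) rmorphM rmorph_nat.
    apply: (@val_geM _ _ _ _ 0 0).
      by rewrite -(rmorph_nat i'); exact: val_ge_const.
    by right; rewrite Pe pa mulr0.
  have cz0 : conj fs w z != 0 by rewrite (conj_eq0 quad).
  have : P z + P (conj fs w z) = 0.
    by rewrite -valuationM// -(fs_norm quad) Pe pn mulr0.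
  have [h|[h|//]] : P z < 0 \/ 0 < P z \/ P z = 0 by ilia.
    move=> hs; have E : P (z + conj fs w z) = P z by apply: val_addl => //; right; ilia.
    have zz : z + conj fs w z != 0.
      by apply: contraTneq h => zz; move: E; rewrite zz valuation0 => <-.
    by have := val_geP zz Ptr; rewrite E; ilia.
  move=> hs; have E : P (z + conj fs w z) = P (conj fs w z).
    by rewrite addrC; apply: val_addl => //; right; ilia.
  have zz : z + conj fs w z != 0.
    apply/eqP => zz; move: E; rewrite zz valuation0; ilia.
  by have := val_geP zz Ptr; rewrite E; ilia.
have [E|E] := (below_above P (below P)).1 erefl.
  by left; exists (below P).
by right; exists (below P).
Qed.

Lemma cover_complete : complete_curve i'.
Proof.
split=> [P|z z0].
  have [->|->] := (below_above P (below P)).1 erefl; last first.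
    by apply: conj_point_residually_constant; exact: above_residually_constant.
  exact: above_residually_constant.
have fz := cover_finite_supp z0; split=> //.
rewrite (fsum_fibre_sum fz).2.
have -> : fibre_sum (fun P => P z) = fun p : closed_point i => p (nm z).
  by apply/funext => p; exact: fibre_sum_val.
by case: (curve.2 (nm z)) => //; rewrite (norm_eq0 quad).
Qed.

End QuadraticCover.

(** * Function fields of curves y^2 = f(x) *)

Section QuadraticSpan.
Variables (K K' : fieldType) (fs : {rmorphism K -> K'}) (w : K') (d : K).
Hypothesis w2 : w ^+ 2 = fs d.
Hypothesis free : forall a b, fs a + fs b * w = 0 -> a = 0 /\ b = 0.

(** These elements form a subfield, so by [function_field_ind] they exhaust a function field whose
    generators lie among them. *)
Definition quadratic_span z := exists ab : K * K, z = fs ab.1 + fs ab.2 * w.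

Lemma quadratic_span_fs a : quadratic_span (fs a).
Proof. by exists (a, 0); rewrite rmorph0 mul0r addr0. Qed.

Lemma quadratic_span_w : quadratic_span w.
Proof. by exists (0, 1); rewrite rmorph0 rmorph1 mul1r add0r. Qed.

Lemma quadratic_spanD z z' :
  quadratic_span z -> quadratic_span z' -> quadratic_span (z + z').
Proof.
move=> [[a b] ->] [[a' b'] ->]; exists (a + a', b + b') => /=.
by rewrite !rmorphD; ring.
Qed.

Lemma quadratic_spanM z z' :
  quadratic_span z -> quadratic_span z' -> quadratic_span (z * z').
Proof.
move=> [[a b] ->] [[a' b'] ->] /=; exists (a * a' + b * b' * d, a * b' + b * a') => /=.
by rewrite !rmorphD !rmorphM -w2; ring.
Qed.

Lemma quadratic_spanV z : quadratic_span z -> quadratic_span z^-1.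
Proof.
have [->|z0] := eqVneq z 0.
  by move=> _; rewrite invr0 -(rmorph0 fs); exact: quadratic_span_fs.
move=> [[a b] /= zE]; pose n := a ^+ 2 - b ^+ 2 * d.
have zz : z * (fs a + fs (- b) * w) = fs n.
  by rewrite zE /n !rmorphN rmorphD rmorphN !rmorphM -w2; ring.
have c0 : fs a + fs (- b) * w != 0.
  apply: contra_neq z0 => /free[a0 /eqP]; rewrite oppr_eq0 => /eqP b0.
  by rewrite zE a0 b0 !rmorph0 mul0r addr0.
have n0 : fs n != 0 by rewrite -zz mulf_neq0.
exists (a / n, - b / n) => /=.
have -> : z^-1 = (fs a + fs (- b) * w) / fs n by rewrite -zz invfM mulrCA divff// mulr1.
by rewrite !fmorph_div; ring.
Qed.

End QuadraticSpan.

Lemma tofracE (R : idomainType) (m : R) :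
  FracField.tofrac m = (\pi_({fraction R}) (Ratio m 1))%qT.
Proof. by unlock FracField.tofrac. Qed.

Lemma fraction_div (R : idomainType) (z : {fraction R}) :
  exists n m, m != 0 /\ z = FracField.tofrac n / FracField.tofrac m.
Proof.
exists (\n_(repr z)%qT), (\d_(repr z)%qT); have m0 := denom_ratioP (repr z)%qT; split=> //.
apply/(canRL (mulfK _)); first by rewrite tofrac_eq0.
rewrite -{1}[z]reprK !tofracE.
rewrite -[LHS]/(FracField.mul _ _) -FracField.pi_mul; apply/eqmodP => /=.
by rewrite FracField.equivfE /FracField.mulf /= !numden_Ratio ?mulr1 ?oner_eq0// mulrC.
Qed.

Section RationalFunctions.
Variable k : closedFieldType.

Local Notation K0 := {fraction {poly k}}.

Definition rat_const : {rmorphism k -> K0} := (@FracField.tofrac _) \o polyC.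

Definition rat_X : K0 := FracField.tofrac 'X.

Lemma evp_tofrac q : evp rat_const rat_X q = FracField.tofrac q.
Proof.
rewrite /evp; elim/poly_ind: q => [|q c IHq]; first by rewrite rmorph0 horner0 rmorph0.
by rewrite rmorphD rmorphM /= map_polyX map_polyC hornerMXaddC IHq rmorphD rmorphM.
Qed.

Lemma rat_X_generator : line_generator rat_const rat_X.
Proof.
split=> [q|z].
  by rewrite evp_tofrac => /eqP; rewrite tofrac_eq0 => /eqP.
have [n [m [m0 ->]]] := fraction_div z; exists n, m.
by rewrite !evp_tofrac tofrac_eq0.
Qed.

Lemma rational_functions_complete : complete_curve rat_const.
Proof. exact: line_complete rat_X_generator. Qed.

End RationalFunctions.

Section FunctionField.
Variables (k : closedFieldType) (K : fieldType) (i : {rmorphism k -> K}).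

Lemma rat_morphism (x : K) : (forall q, evp i x q = 0 -> q = 0) ->
  exists phi : {rmorphism {fraction {poly k}} -> K},
    forall q, phi (FracField.tofrac q) = evp i x q.
Proof.
move=> inj; pose phi (z : {fraction {poly k}}) :=
  evp i x \n_(repr z)%qT / evp i x \d_(repr z)%qT.
have nz q : q != 0 -> evp i x q != 0 by apply: contra_neq; exact: inj.
(* Independence of the representative chosen by [repr]; the ring laws all follow from it. *)
have phiE n m : m != 0 ->
    phi (FracField.tofrac n / FracField.tofrac m) = evp i x n / evp i x m.
  move=> m0; set z := (_ / _ : {fraction {poly k}}).
  have r0 := denom_ratioP (repr z)%qT.
  have zE : z = FracField.tofrac \n_(repr z)%qT / FracField.tofrac \d_(repr z)%qT.
    rewrite -{1}[z]reprK !tofracE; apply/(canRL (mulfK _)).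
      by rewrite -tofracE tofrac_eq0.
    rewrite -[LHS]/(FracField.mul _ _) -FracField.pi_mul; apply/eqmodP => /=.
    by rewrite FracField.equivfE /FracField.mulf /= !numden_Ratio ?mulr1 ?oner_eq0// mulrC.
  have E : n * \d_(repr z)%qT = \n_(repr z)%qT * m.
    apply/eqP; rewrite -tofrac_eq !tofracM; apply/eqP.
    move/eqP: zE; rewrite /z eqr_div ?tofrac_eq0// => /eqP ->.
    by rewrite mulrC.
  rewrite /phi; apply/eqP; rewrite eqr_div ?nz//.
  by rewrite -!evpM -E mulrC.
have phi1 : phi 1 = 1.
  have := phiE 1 1 (oner_neq0 _); rewrite tofrac1 divr1 => ->.
  by rewrite divff// nz// oner_neq0.
have phiM : {morph phi : a b / a * b}.
  move=> a b; have [n [m [m0 ->]]] := fraction_div a; have [n' [m' [m'0 ->]]] := fraction_div b.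
  rewrite mulf_div -!tofracM !phiE ?mulf_neq0// !evpM.
  by rewrite mulf_div.
have phiB : {morph phi : a b / a - b}.
  move=> a b; have [n [m [m0 ->]]] := fraction_div a; have [n' [m' [m'0 ->]]] := fraction_div b.
  rewrite -mulNr -tofracN addf_div ?tofrac_eq0// -!tofracM -tofracD !phiE ?mulf_neq0//.
  rewrite evpD !evpM evpN -mulNr addf_div ?nz//.
pose f : {rmorphism {fraction {poly k}} -> K} :=
  HB.pack phi (GRing.isZmodMorphism.Build _ _ phi phiB)
    (GRing.isMonoidMorphism.Build _ _ phi (phi1, phiM)).
exists f => q; have := phiE q 1 (oner_neq0 _).
rewrite tofrac1 divr1 -[f _]/(phi _) => ->.
by rewrite -[1]/(1%:P) evpC rmorph1 divr1.
Qed.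

Lemma function_field_ind F (x y : K) (S : K -> Prop) : function_field_of i F x y ->
  (forall c, S (i c)) -> S x -> S y -> (forall z z', S z -> S z' -> S (z + z')) ->
  (forall z z', S z -> S z' -> S (z * z')) -> (forall z, S z -> S z^-1) ->
  forall z, S z.
Proof.
move=> [_ gen] Sc Sx Sy SD SM SV z; have [N [D [_ ->]]] := gen z.
have S0 : S 0 by rewrite -(rmorph0 i).
have Sev (q : {poly k}) : S (map_poly i q).[x].
  elim/poly_ind: q => [|q c IHq]; first by rewrite rmorph0 horner0.
  rewrite rmorphD rmorphM /= map_polyX map_polyC hornerMXaddC /=.
  by apply: SD => //; exact: SM.
have SEV (M : {poly {poly k}}) : S (map_poly (map_poly i) M).[y%:P].[x].
  elim/poly_ind: M => [|M q IHM]; first by rewrite rmorph0 !horner0.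
  rewrite rmorphD rmorphM /= map_polyX map_polyC hornerMXaddC /=.
  by rewrite hornerD hornerM hornerC; apply: SD => //; exact: SM.
by apply: SM => //; exact: SV.
Qed.

(** A polynomial of degree at most 1 in [Y] is a multiple of the monic quadratic [Y^2 - f] only if
    it is 0; this yields both the transcendence of [x] and the freeness of [1, y]. *)
Lemma quadratic_function_field (f : {poly k}) (x y : K) :
  function_field_of i ('X^2 - f%:P) x y ->
  exists phi : {rmorphism {fraction {poly k}} -> K},
    [/\ forall c, phi (rat_const k c) = i c, phi (rat_X k) = x
      & quadratic_extension phi y (FracField.tofrac f)].
Proof.
move=> hff; have [ker gen] := hff.
have evE N (q q' : {poly k}) : N = q%:P + q'%:P * 'X ->
    (map_poly (map_poly i) N).[y%:P].[x] = evp i x q + evp i x q' * y.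
  move=> ->; rewrite rmorphD rmorphM /= map_polyX !map_polyC /= !hornerE /=.
  by [].
have small (q q' : {poly k}) : evp i x q + evp i x q' * y = 0 -> q = 0 /\ q' = 0.
  rewrite -(evE _ _ _ erefl) => /ker[G NE].
  have N0 : q%:P + q'%:P * 'X = 0 :> {poly {poly k}}.
    apply/eqP/negPn/negP => N0; have G0 : G != 0.
      by apply: contra_neq N0 => G0; rewrite NE G0 mulr0.
    have := congr1 (size \o @polyseq _) NE => /=.
    rewrite size_monicM ?monicXnsubC// size_XnsubC//.
    have : (size (q%:P + q'%:P * 'X : {poly {poly k}})%R <= 2)%N.
      rewrite addrC size_MXaddC; case: ifP => // _.
      by rewrite ltnS size_polyC leq_b1.
    move: G0; rewrite -size_poly_gt0; case: (size G) => // s.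
    by rewrite addnS /= => _ h1 h2; rewrite h2 in h1.
  split.
    have := congr1 (fun M : {poly {poly k}} => M`_0) N0.
    by rewrite /= coefD coefMX !coefC eqxx addr0.
  have := congr1 (fun M : {poly {poly k}} => M`_1) N0.
  by rewrite /= coefD coefMX !coefC eqxx add0r.
have inj q : evp i x q = 0 -> q = 0.
  move=> q0; have [] := small q 0 => //.
  by rewrite q0 /evp rmorph0 horner0 mul0r addr0.
have [phi phiE] := rat_morphism inj.
have y2 : y ^+ 2 = phi (FracField.tofrac f).
  have /ker : exists G, 'X^2 - f%:P = ('X^2 - f%:P) * G by exists 1; rewrite mulr1.
  rewrite rmorphB /= map_polyC map_polyXn /= !hornerE phiE.
  by move/eqP; rewrite subr_eq0 => /eqP.
have free a b : phi a + phi b * y = 0 -> a = 0 /\ b = 0.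
  have [n [m [m0 ->]]] := fraction_div a; have [n' [m' [m'0 ->]]] := fraction_div b.
  have pm : phi (FracField.tofrac m) != 0 by rewrite fmorph_eq0 tofrac_eq0.
  have pm' : phi (FracField.tofrac m') != 0 by rewrite fmorph_eq0 tofrac_eq0.
  rewrite !fmorph_div => E.
  have /small[] : evp i x (n * m') + evp i x (n' * m) * y = 0.
    rewrite !evpM -!phiE.
    have -> : phi (FracField.tofrac n) * phi (FracField.tofrac m') +
        phi (FracField.tofrac n') * phi (FracField.tofrac m) * y =
      phi (FracField.tofrac m) * phi (FracField.tofrac m') *
        (phi (FracField.tofrac n) / phi (FracField.tofrac m) +
         phi (FracField.tofrac n') / phi (FracField.tofrac m') * y).
      by field; rewrite pm pm'.
    by rewrite E mulr0.
  move=> /eqP; rewrite mulf_eq0 (negPf m'0) orbF => /eqP ->.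
  move=> /eqP; rewrite mulf_eq0 (negPf m0) orbF => /eqP ->.
  by rewrite tofrac0 !mul0r.
exists phi; split.
- by move=> c; rewrite phiE evpC.
- by rewrite phiE evpX.
split=> //; apply: (function_field_ind hff).
- by move=> c; rewrite -(evpC i x) -phiE; exact: quadratic_span_fs.
- by rewrite -(evpX i x) -phiE; exact: quadratic_span_fs.
- exact: quadratic_span_w.
- exact: quadratic_spanD.
- exact: (quadratic_spanM y2).
- exact: (quadratic_spanV y2 free).
Qed.

End FunctionField.

(** * Frames and degrees *)

Section Frames.
Variables (k K : fieldType) (i : {rmorphism k -> K}) (V : lmodType K).
Variable n : nat.
Implicit Types (P : closed_point i) (e f : 'I_n -> V) (A B C : 'M[K]_n).

Definition mxframe A e : 'I_n -> V := fun j => \sum_(l < n) A j l *: e l.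

Lemma mxframeM A B e : mxframe (A *m B) e = mxframe A (mxframe B e).
Proof.
apply/funext => j; rewrite /mxframe.
under eq_bigr do rewrite mxE scaler_suml.
rewrite exchange_big; apply: eq_bigr => m _ /=.
by rewrite scaler_sumr; apply: eq_bigr => l _; rewrite scalerA.
Qed.

Lemma mxframe1 e : mxframe 1%:M e = e.
Proof.
apply/funext => j; rewrite /mxframe (bigD1 j)//= mxE eqxx scale1r big1 ?addr0// => l lj.
by rewrite mxE eq_sym (negPf lj) scale0r.
Qed.

Lemma mxframe_inj A B e : independent e -> mxframe A e = mxframe B e -> A = B.
Proof.
move=> ind AB; apply/matrixP => j l; apply/eqP; rewrite -subr_eq0; apply/eqP.
apply: (ind (fun l => A j l - B j l)).
under eq_bigr do rewrite scalerBl.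
by rewrite sumrB -[X in X - _]/(mxframe A e j) AB subrr.
Qed.

Lemma local_span_frame P f j : local_span P f (f j).
Proof.
exists (fun l => (j == l)%:R) => [l|].
  by case: (j == l); [right; rewrite val1|left].
rewrite (bigD1 j)//= eqxx scale1r big1 ?addr0// => l lj.
by rewrite eq_sym (negPf lj) scale0r.
Qed.

Lemma local_span_sub P f f' : local_span P f' `<=` local_span P f ->
  exists2 C : 'M[K]_n, (forall j l, regular_at P (C j l)) & f' = mxframe C f.
Proof.
move=> sub; have h j : exists c : 'I_n -> K,
    (forall l, regular_at P (c l)) /\ f' j = \sum_(l < n) c l *: f l.
  by have [c cr cE] := sub _ (local_span_frame P f' j); exists c.
have [c cP] := choice h.
exists (\matrix_(j, l) c j l) => [j l|]; first by rewrite mxE; case: (cP j).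
apply/funext => j; case: (cP j) => _ ->; apply: eq_bigr => l _.
by rewrite mxE.
Qed.

Lemma regular_det P C : (forall j l, regular_at P (C j l)) -> regular_at P (\det C).
Proof.
move=> reg; rewrite /determinant; apply: (big_ind (val_ge P 0)).
- by left.
- by move=> a b; exact: val_geD.
move=> s _; rewrite -[X in val_ge P X _]addr0; apply: val_geM.
  by case: (perm.odd_perm s); right; rewrite ?expr1 ?expr0 ?val1 ?valN1.
apply: (big_ind (val_ge P 0)).
- by right; rewrite val1.
- by move=> a b; exact: (@val_geM _ _ _ _ 0 0).
by move=> j _; exact: reg.
Qed.

Lemma framed_finite_supp (E : closed_point i -> set V) e g : framed_by E e g ->
  finite_supp (fun P => P (\det (g P))).
Proof.
move=> [_ _ fin _]; apply: sub_finite_set fin => P /= Pg gP; apply: Pg.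
by rewrite gP det1 val1.
Qed.

Hypothesis curve : complete_curve i.

(** Locally the two frames differ by an invertible regular matrix, globally the bases differ by one
    matrix [A] over [K]. Hence the two sums differ by the degree of the divisor of [\det A], which
    is 0. *)
Lemma framed_degree_unique (E : closed_point i -> set V) e e' g g' :
  framed_by E e g -> framed_by E e' g' ->
  fsum (fun P => P (\det (g P))) = fsum (fun P => P (\det (g' P))).
Proof.
move=> fr fr'; have [ind gU _ EP] := fr; have [ind' gU' _ EP'] := fr'.
have [[P0 _]|noP] := pselect (exists P : closed_point i, True); last first.
  by congr fsum; apply/funext => P; case: noP; exists P.
have trans P : exists2 C : 'M[K]_n, (forall j l, regular_at P (C j l)) &
    mxframe (g' P) e' = mxframe C (mxframe (g P) e).
  by apply: local_span_sub; rewrite -[X in _ `<=` X]EP EP'.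
have trans' P : exists2 C : 'M[K]_n, (forall j l, regular_at P (C j l)) &
    mxframe (g P) e = mxframe C (mxframe (g' P) e').
  by apply: local_span_sub; rewrite -[X in _ `<=` X]EP' EP.
have [C _ CE] := trans P0; have [C' _ C'E] := trans' P0.
pose A := invmx (g' P0) *m (C *m g P0); pose B := invmx (g P0) *m (C' *m g' P0).
have e'E : e' = mxframe A e.
  by rewrite !mxframeM -CE -mxframeM mulVmx// mxframe1.
have eE : e = mxframe B e'.
  by rewrite !mxframeM -C'E -mxframeM mulVmx// mxframe1.
clearbody A B.
have BA : B *m A = 1%:M.
  by apply: (mxframe_inj ind); rewrite mxframe1 mxframeM -e'E -eE.
have dBA : \det B * \det A = 1 by rewrite -det_mulmx BA det1.
have dA : \det A != 0.
  by apply/eqP => dA; move/eqP: dBA; rewrite dA mulr0 eq_sym oner_eq0.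
have dB : \det B != 0.
  by apply/eqP => dB; move/eqP: dBA; rewrite dB mul0r eq_sym oner_eq0.
have gdet P : \det (g P) != 0 by rewrite -unitfE -unitmxE.
have gdet' P : \det (g' P) != 0 by rewrite -unitfE -unitmxE.
have PBA P : P (\det B) + P (\det A) = 0 by rewrite -valuationM// dBA val1.
have key P : P (\det (g P)) = P (\det (g' P)) + P (\det A).
  have [D Dreg DE] := trans P; have [D' D'reg D'E] := trans' P.
  have /(congr1 determinant) : g' P *m A = D *m g P.
    by apply: (mxframe_inj ind); rewrite !mxframeM -e'E.
  have /(congr1 determinant) : g P *m B = D' *m g' P.
    by apply: (mxframe_inj ind'); rewrite !mxframeM -eE.
  rewrite !det_mulmx => E1 E2.
  have D0 : \det D != 0.
    by apply: contraTneq (mulf_neq0 (gdet' P) dA) => D0; rewrite E2 D0 mul0r eqxx.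
  have D'0 : \det D' != 0.
    by apply: contraTneq (mulf_neq0 (gdet P) dB) => D'0; rewrite E1 D'0 mul0r eqxx.
  have h1 := val_geP D0 (regular_det Dreg).
  have h2 := val_geP D'0 (regular_det D'reg).
  have E3 : P (\det (g' P)) + P (\det A) = P (\det D) + P (\det (g P)).
    by rewrite -!valuationM// E2.
  have E4 : P (\det (g P)) + P (\det B) = P (\det D') + P (\det (g' P)).
    by rewrite -!valuationM// E1.
  by have := PBA P; ilia.
have [fA sA] := curve.2 _ dA.
rewrite (_ : (fun P => P (\det (g P))) = fun P => P (\det (g' P)) + P (\det A)).
  by rewrite fsumD ?sA ?addr0//; exact: framed_finite_supp fr'.
exact/funext.
Qed.

Lemma degreeE (E : closed_point i -> set V) e g : framed_by E e g ->
  degree n E = - fsum (fun P => P (\det (g P))).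
Proof.
move=> fr; rewrite /degree; set S := [set _ | _].
have [e' [g' [fr' ->]]] : S (xget 0 S).
  by apply: xgetPex; exists (- fsum (fun P => P (\det (g P)))), e, g.
by congr (- _); exact: framed_degree_unique fr' fr.
Qed.

End Frames.

(** * Line bundles as order functions *)

Section Lines.
Variables (k K : fieldType) (i : {rmorphism k -> K}).
Hypothesis curve : complete_curve i.
Implicit Types (m : closed_point i -> int) (P : closed_point i).

(** This is [O(-m)]: [m P] is the order of a local generator, and the degree is minus the sum of
    [m]. *)
Definition order_line m : line_sheaf i := fun P => [set v | val_ge P (m P) v].

Lemma val_ge_inj P (m n : int) :
  [set v | val_ge P m v] `<=` [set v | val_ge P n v] -> n <= m.
Proof.
have [u u0 Pu] := valuation_unif P; move=> /(_ (u ^ m)) /=.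
rewrite /val_ge valXz// Pu mulr1 => -[|/eqP|//]; first by right.
by rewrite expfz_eq0 (negPf u0) andbF.
Qed.

Lemma line_bundle_order (L : line_sheaf i) : vector_bundle 1 L -> exists m,
  [/\ finite_supp m, fsum m = - degree 1 L & L = order_line m].
Proof.
move=> [e [g fr]]; have [ind gU _ LE] := fr; pose a : K := e ord0.
have a0 : a != 0.
  apply/eqP => a0; have := ind (fun _ => 1); rewrite big_ord1 -/a a0 scaler0.
  by move=> /(_ erefl ord0)/eqP; rewrite oner_eq0.
have g0 P : g P ord0 ord0 != 0.
  by have := gU P; rewrite unitmxE det_mx11 unitfE.
have [fa sa] := curve.2 _ a0.
have fg := framed_finite_supp fr.
exists (fun P => P (\det (g P)) + P a); split; first exact: finite_suppD.
  by rewrite fsumD// sa addr0 (degreeE curve fr) opprK.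
apply/funext => P; rewrite LE; apply/seteqP; rewrite /order_line det_mx11; split=> v /=.
  move=> [c creg ->]; rewrite !big_ord1 -/a.
  rewrite -[X in val_ge P X]add0r; apply: val_geM; first exact: creg.
  by right; rewrite -[X in _ <= P X]/(g P ord0 ord0 * a) valuationM.
move=> vP; exists (fun=> v / (g P ord0 ord0 * a)).
  by move=> _; apply: val_ge_div; rewrite ?mulf_neq0// ?valuationM// add0r.
by rewrite !big_ord1 -/a -[RHS]/(_ * (_ * a)) divfK// mulf_neq0.
Qed.

Lemma order_line_bundle m : finite_supp m ->
  vector_bundle 1 (order_line m) /\ degree 1 (order_line m) = - fsum m.
Proof.
(* The generator is taken to be 1 wherever [m] vanishes, so that the frame is constant almost
   everywhere. *)
move=> fm; have h P : exists a : K, [/\ a != 0, P a = m P & m P = 0 -> a = 1].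
  have [->|m0] := eqVneq (m P) 0; first by exists 1; rewrite oner_eq0 val1.
  have [u u0 Pu] := valuation_unif P; exists (u ^ m P).
  rewrite expfz_neq0// valXz// Pu mulr1; split=> // m00.
  by rewrite m00 eqxx in m0.
have [a aP] := choice h.
pose g P : 'M[K]_1 := (a P)%:M.
have fr : @framed_by _ _ _ K^o 1 (order_line m) (fun=> 1) g.
  split.
  - move=> c; rewrite big_ord1 => c0 j; rewrite (ord1 j); move: c0.
    by rewrite -[_ *: _]/(c ord0 * 1) mulr1.
  - by move=> P; rewrite unitmxE det_scalar1 unitfE; case: (aP P).
  - apply: sub_finite_set fm => P /= gP mP; apply: gP.
    by rewrite /g; case: (aP P) => _ _ ->.
  - move=> P; have [a0 Pa _] := aP P; apply/seteqP; split=> v /=.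
    + move=> vP; exists (fun=> v / a P).
        by move=> _; apply: val_ge_div; rewrite ?Pa// add0r.
      by rewrite !big_ord1 mxE eqxx mulr1n -[RHS]/(_ * (_ * 1)) mulr1 divfK.
    + move=> [c creg ->]; rewrite /order_line /= !big_ord1 mxE eqxx mulr1n.
      rewrite -[X in val_ge P X]add0r; apply: val_geM; first exact: creg.
      by right; rewrite -[X in _ <= P X]/(a P * 1) mulr1 Pa.
split; first by exists (fun=> 1), g.
rewrite (degreeE curve fr); congr (- fsum _); apply/funext => P.
by rewrite det_scalar1; case: (aP P).
Qed.

End Lines.

(** * Direct images under a double cover *)

Section DirectImage.
Variables (k : closedFieldType) (K K' : fieldType).
Variables (i : {rmorphism k -> K}) (i' : {rmorphism k -> K'}).
Variable fs : {rmorphism K -> K'}.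
Variables (w : K') (d : K).
Hypothesis hfs : forall c, fs (i c) = i' c.
Hypothesis quad : quadratic_extension fs w d.
Hypothesis char2 : 2%:R != 0 :> k.
Hypothesis curve : complete_curve i.
Implicit Types (p : closed_point i) (P Q : closed_point i') (a b : K) (z : K').

Local Notation sg := (conj_point hfs quad).
Local Notation nm := (norm fs w d).
Local Notation cj := (conj fs w).
Local Notation below := (below hfs quad).
Local Notation above := (above hfs quad char2 curve).
Local Notation fib := (fibre_sum hfs quad char2 curve).

Lemma finite_supp_pullback (f : closed_point i -> int) :
  finite_supp f -> finite_supp (fun P => f (below P)).
Proof.
move=> fS; set S := [set p | f p <> 0] in fS.
have fU : finite_set ((above @` S) `|` ((fun p => sg (above p)) @` S)).
  by rewrite finite_setU; split; exact: finite_image.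
apply: sub_finite_set fU => P /= Pf.
have [E|E] := (below_above hfs quad char2 curve P (below P)).1 erefl.
  by left; exists (below P).
by right; exists (below P).
Qed.

Lemma scale_restrictE a (v : restrict_scalars fs) : a *: v = fs a * (v : K').
Proof. by []. Qed.

(* 1 and c w form an integral basis above p: (c w)^2 = c^2 d has valuation 0 or 1
   at p, so an integral a + b c w, having integral trace and norm, has a and b
   integral. *)
Lemma integral_basis p c z : c != 0 -> p c = - (p d %/ 2)%Z ->
  (forall P, maps_to fs P p -> val_ge P 0 z) <->
  exists a b, [/\ regular_at p a, regular_at p b & z = fs a + fs b * (fs c * w)].
Proof.
move=> c0 pc; have d0 := d_neq0 quad.
have [w2 _ _] := quad.
have pd0 : 0 <= p (c ^+ 2 * d) <= 1.
  rewrite valuationM ?expf_neq0// valX// pc.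
  have := divz_eq (p d) 2; have := modz_ge0 (p d) (isT : (2 : int) != 0).
  have := ltz_pmod (p d) (isT : (0 : int) < 2); ilia.
have e0 : c ^+ 2 * d != 0 by rewrite mulf_neq0// expf_neq0.
have w2' := sqr_scale quad c.
split=> [zP|[a [b [ra rb ->]]] P Pp]; last first.
  apply: val_geD; first exact: maps_to_val_ge Pp _ ra.
  rewrite -(addr0 0); apply: val_geM; first exact: maps_to_val_ge Pp _ rb.
  right; have : val_ge P 0 (fs (c ^+ 2 * d)).
    by apply: maps_to_val_ge Pp _ _ => //; right; case/andP: pd0.
  move/val_geP; rewrite fmorph_eq0 => /(_ e0); rewrite -w2' valX; first by ilia.
  by apply/eqP => h; move: e0; rewrite -(fmorph_eq0 fs) -w2' h expr0n /= eqxx.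
have [a [b zE]] := gen_scale quad z c0.
pose P := above p; have Pp : maps_to fs P p.
  by apply/(maps_to_below hfs quad)/(below_above hfs quad char2 curve); left.
have down n : val_ge P 0 (fs n) -> val_ge p 0 n.
  have [->|n0] := eqVneq n 0; first by left.
  have /maps_toP[e [e_gt0 Pe]] := Pp.
  move/val_geP; rewrite fmorph_eq0 => /(_ n0); rewrite Pe pmulr_rge0//.
  by right.
have cz : val_ge P 0 (cj z).
  have := zP _ (maps_to_conj hfs quad Pp); have [->|z0] := eqVneq z 0.
    by move=> _; left; rewrite -(rmorph0 fs) (conj_fs quad).
  by move/(val_geP z0); right.
have two : i 2%:R != 0 by rewrite fmorph_eq0.
have czE : cj z = fs a - fs b * (fs c * w).
  by rewrite zE (conjD quad) !(conjM quad) !(conj_fs quad) (conj_w quad) !mulrN.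
have ra : val_ge p 0 a.
  have : val_ge p 0 (i 2%:R * a).
    apply: down; have -> : fs (i 2%:R * a) = z + cj z.
      by rewrite czE zE rmorphM rmorph_nat rmorph_nat; ring.
    by apply: val_geD => //; exact: zP.
  have [->|a0] := eqVneq a 0; first by left.
  move/(val_geP (mulf_neq0 two a0)).
  by rewrite valuationM// valuation_const// add0r; right.
exists a, b; split=> //.
have : val_ge p 0 (a ^+ 2 - b ^+ 2 * (c ^+ 2 * d)).
  apply: down; have -> : fs (a ^+ 2 - b ^+ 2 * (c ^+ 2 * d)) = z * cj z.
    by rewrite czE zE rmorphB [fs (b ^+ 2 * _)]rmorphM !rmorphXn -w2'; ring.
  by apply: (@val_geM _ _ _ _ 0 0) => //; exact: zP.
have : val_ge p 0 (a ^+ 2) by exact: (@val_geM _ _ _ _ 0 0).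
move=> h1 h2; have := val_geB h1 h2; rewrite opprB addrC subrK.
have [->|b0] := eqVneq b 0; first by left.
have b20 : b ^+ 2 != 0 by rewrite expf_neq0.
move/(val_geP (mulf_neq0 b20 e0)); rewrite valuationM// valX//.
by move=> h; right; case/andP: pd0 => _; ilia.
Qed.

(** [f_* O] is [O + O(half_div) w], so the sum of this function is the degree of [f_* O], minus half
    the number of branch points. *)
Definition half_div p : int := (p d %/ 2)%Z.

(* Near p, f_* L is mu f_* O for any mu with the prescribed orders above p, so the
   degree of f_* L is that of f_* O shifted by the degree of L through the norm. *)
Lemma direct_image_frame (m : closed_point i' -> int) : finite_supp m ->
  exists e g, @framed_by _ _ i (restrict_scalars fs) 2 (direct_image i fs (order_line m)) e g /\
   fsum (fun p => p (\det (g p))) = fsum m - fsum half_div.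
Proof.
move=> fm; have [w2 free _] := quad.
have fd : finite_supp (fun p : closed_point i => p d) by case: (curve.2 _ (d_neq0 quad)).
have fh : finite_supp half_div.
  by apply: finite_supp_sub fd => p pd; rewrite /half_div pd div0z.
(* A generator of [L] along the whole fibre over [p], obtained by approximation, and equal to 1
   outside a finite set. *)
have hmu p : exists z, [/\ z != 0, above p z = m (above p), sg (above p) z = m (sg (above p))
    & m (above p) = 0 -> m (sg (above p)) = 0 -> z = 1].
  have [[m0 m0']|nz] := pselect (m (above p) = 0 /\ m (sg (above p)) = 0).
    by exists 1; rewrite !val1 m0 m0' oner_eq0.
  have [|z [z0 z1 z2]] := @above_approx _ _ _ _ _ _ _ _ hfs quad char2 curve p
    (m (above p)) (m (sg (above p))).
    by move=> <-.
  by exists z; split=> // m0 m0'; case: nz.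
have [mu muP] := choice hmu.
have hc p : exists c : K, [/\ c != 0, p c = - half_div p & half_div p = 0 -> c = 1].
  have [->|h0] := eqVneq (half_div p) 0; first by exists 1; rewrite oner_eq0 val1.
  have [u u0 pu] := valuation_unif p; exists (u ^ - half_div p).
  rewrite expfz_neq0// valXz// pu mulr1; split=> // h00.
  by rewrite h00 eqxx in h0.
have [c cP] := choice hc.
pose e (j : 'I_2) : restrict_scalars fs := if j == ord0 then 1 else w.
(* The rows are the coordinates of [mu p] and [c p * w * mu p] in the basis [1, w]; the determinant
   is therefore [c p] times a norm. *)
pose g p : 'M[K]_2 := \matrix_(j, l)
  let ab := coord fs w (mu p) in
  if j == ord0 then (if l == ord0 then ab.1 else ab.2)
  else (if l == ord0 then c p * ab.2 * d else c p * ab.1).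
have detg p : \det (g p) = c p * nm (mu p).
  rewrite (expand_det_row _ ord0) !big_ord_recl big_ord0 /cofactor !det_mx11 !mxE /=.
  by rewrite /norm; ring.
have fmb : finite_set (below @` [set P | m P <> 0]) by exact: finite_image.
exists e, g; split; last first.
  rewrite (_ : (fun p => _) = fun p => fib m p + - half_div p).
    have [fS ->] := fsum_fibre_sum hfs quad char2 curve fm.
    by rewrite fsumD ?fsumN//; exact: finite_suppN.
  apply/funext => p; have [c0 pc _] := cP p; have [mu0 mu1 mu2 _] := muP p.
  rewrite detg valuationM ?(norm_eq0 quad)// pc addrC; congr (_ + _).
  rewrite -(fibre_sum_val hfs quad char2 curve p mu0) /fibre_sum.
  by rewrite -mu1 -mu2.
split.
- move=> a; rewrite !big_ord_recl big_ord0 addr0 /e /= !scale_restrictE mulr1.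
  move=> /free[a0 a1] j; case: (unliftP ord0 j) => [l|] ->; last by [].
  by rewrite (ord1 l).
- by move=> p; rewrite unitmxE detg unitfE mulf_neq0 ?(norm_eq0 quad)//;
    [case: (cP p)|case: (muP p)].
- have fU : finite_set ([set p | half_div p <> 0] `|` (below @` [set P | m P <> 0])).
    by rewrite finite_setU.
  apply: sub_finite_set fU => p /= gp; apply: contrapT => /not_orP[/contrapT h0 nb].
  apply: gp; have [_ _ /(_ h0) cE] := cP p.
  have m0 P : below P = p -> m P = 0.
    by move=> bP; apply: contrapT => mP; apply: nb; exists P.
  have muE : mu p = 1.
    have [_ _ _] := muP p; apply; apply: m0; apply/(below_above hfs quad char2 curve).
      by left.
    by right.
  have cd1 : coord fs w 1 = (1, 0).
    by have := coord_fs quad 1 0; rewrite rmorph0 rmorph1 mul0r addr0.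
  apply/matrixP => j l; rewrite !mxE muE cE cd1 /=.
  case: (unliftP ord0 j) => [j'|] ->; case: (unliftP ord0 l) => [l'|] -> //=.
  + by rewrite (ord1 j') (ord1 l') /= mulr1.
  + by rewrite mulr0 mul0r.
move=> p; have [c0 pc _] := cP p; have [mu0 mu1 mu2 _] := muP p.
pose ab := coord fs w (mu p).
pose row j := \sum_(l < 2) g p j l *: e l.
have row0 : row ord0 = mu p.
  rewrite /row !big_ord_recl big_ord0 addr0 !mxE /e /= !scale_restrictE mulr1.
  by rewrite -(coordE quad).
have row1 : row (lift ord0 ord0) = fs (c p) * w * mu p.
  rewrite /row !big_ord_recl big_ord0 addr0 !mxE /e /= !scale_restrictE mulr1.
  by rewrite [in RHS](coordE quad (mu p)) !rmorphM -w2; ring.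
have spanE v : local_span p row v <->
    exists a b, [/\ regular_at p a, regular_at p b & v / mu p = fs a + fs b * (fs (c p) * w)].
  clearbody row; split=> [[a ra ->]|[a [b [ra rb vE]]]].
    exists (a ord0), (a (lift ord0 ord0)); split=> //.
    rewrite !big_ord_recl big_ord0 addr0 row0 row1 !scale_restrictE.
    by field.
  exists (fun j => if j == ord0 then a else b); first by move=> j; case: ifP.
  rewrite !big_ord_recl big_ord0 addr0 row0 row1 /= !scale_restrictE.
  by rewrite -[LHS](divfK mu0) vE; ring.
have muP' P : maps_to fs P p -> P (mu p) = m P.
  move/(maps_to_below hfs quad)/(below_above hfs quad char2 curve) => [] ->//.
apply/seteqP; split=> v /=.
  move=> vL; apply/spanE; apply/(integral_basis _ c0 pc) => P Pp.
  by apply: val_ge_div => //; rewrite ?muP'// add0r; exact: vL.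
move=> /spanE/(integral_basis _ c0 pc) h P Pp; rewrite /order_line /= -(muP' _ Pp).
have -> : v = v / mu p * mu p by rewrite divfK.
by rewrite -[X in val_ge P X]add0r; apply: val_geM (val_ge_refl _ _); exact: h.
Qed.

Lemma direct_image_bundle (m : closed_point i' -> int) : finite_supp m ->
  vector_bundle 2 (direct_image i fs (order_line m)) /\
  degree 2 (direct_image i fs (order_line m)) = fsum half_div - fsum m.
Proof.
move=> /direct_image_frame[e [g [fr gE]]]; split; first by exists e, g.
by rewrite (degreeE curve fr) gE opprB.
Qed.

Lemma fsum_pullback (b : closed_point i -> K) : (forall p, b p != 0) ->
  finite_supp (fun p => p (b p)) ->
  finite_supp (fun P => P (fs (b (below P)))) /\
  fsum (fun P => P (fs (b (below P)))) = 2 * fsum (fun p => p (b p)).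
Proof.
move=> b0 fb; have fp : finite_supp (fun P => P (fs (b (below P)))).
  apply: finite_supp_sub (finite_supp_pullback fb) => P bP.
  have /maps_toP[e [_ ->]] : maps_to fs P (below P) by apply/(maps_to_below hfs quad).
  by rewrite bP mulr0.
split=> //; have [_ ->] := fsum_fibre_sum hfs quad char2 curve fp.
rewrite (_ : fibre_sum _ _ _ _ _ = fun p => p (b p) + p (b p)).
  by rewrite fsumD// mulr_natl.
apply/funext => p; rewrite (fibre_sum_fs hfs quad char2 curve p b); ilia.
Qed.

(* A line subbundle of nonnegative degree gives a section s of L (x) f^* M^-1,
   whose divisor is effective of degree at most 0, hence zero: L is isomorphic
   to f^* M, and its order function is sg-invariant up to a principal divisor. *)
Lemma line_subbundle_direct_image (m : closed_point i' -> int) M :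
  finite_supp m -> fsum m = 0 -> line_subbundle M (direct_image i fs (order_line m)) ->
  degree 1 M < 0 \/ exists2 u, u != 0 & forall P, m P - m (sg P) = P u.
Proof.
move=> fm sm [[e [g fr]] sub]; have [ind gU _ ME] := fr.
pose s : K' := e ord0; pose b p := \det (g p).
have b0 p : b p != 0 by rewrite -unitfE -unitmxE.
have s0 : s != 0.
  apply/eqP => s0; have := ind (fun _ => 1); rewrite big_ord1 -/s s0 scaler0.
  by move=> /(_ erefl ord0)/eqP; rewrite oner_eq0.
(* [M] is locally spanned by a vector of a frame of the direct image, so its generator [b s] is a
   section of [L] at every point above. *)
have bs P : val_ge P (m P) (fs (b (below P)) * s).
  have [e' [_ E'E M'E]] := sub (below P).
  have : M (below P) (fs (b (below P)) * s).
    rewrite ME; exists (fun=> 1); first by move=> _; right; rewrite val1.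
    by rewrite !big_ord1 scale1r /b det_mx11.
  rewrite M'E => -[c creg vE].
  have : direct_image i fs (order_line m) (below P) (fs (b (below P)) * s).
    rewrite E'E; exists (fun j => if j == ord0 then c ord0 else 0).
      by move=> j; case: ifP => // _; left.
    by rewrite vE big_ord1 !big_ord_recl big_ord0 /= scale0r !addr0.
  by apply; apply/(maps_to_below hfs quad).
have fb := framed_finite_supp fr.
have dM : degree 1 M = - fsum (fun p => p (b p)) := degreeE curve fr.
have [fB sB] := fsum_pullback b0 fb.
have [fs' ss] := (cover_complete hfs quad char2 curve).2 _ s0.
(* The divisor of [s] as a section of [L (x) f^* M^-1], of degree [-2 deg M]. *)
pose D P := P (fs (b (below P))) + P s + - m P.
have D0 P : 0 <= D P.
  have fb0 : fs (b (below P)) != 0 by rewrite fmorph_eq0.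
  have := val_geP (mulf_neq0 fb0 s0) (bs P).
  by rewrite valuationM// /D subr_ge0.
have fD : finite_supp D.
  by apply: finite_suppD; [exact: finite_suppD|exact: finite_suppN].
have sD : fsum D = 2 * fsum (fun p => p (b p)).
  rewrite /D fsumD; [|exact: finite_suppD|exact: finite_suppN].
  by rewrite fsumD// fsumN sB ss sm oppr0 !addr0.
have [h|h] : degree 1 M < 0 \/ 0 <= degree 1 M by ilia.
  by left.
right; have D00 : forall P, D P = 0.
  apply: fsum_eq0 => //; have := fsum_ge0 D0; rewrite sD; move: h; rewrite dM; ilia.
(* With [D = 0], [m] is the divisor of [s] plus a pullback from the base; the pullback is invariant
   under [sg] and cancels. *)
exists (s / cj s); first by rewrite mulf_neq0 ?invr_eq0 ?(conj_eq0 quad).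
move=> P; have := D00 P; have := D00 (sg P).
rewrite /D (below_conj hfs quad) val_div ?(conj_eq0 quad)// !conj_pointE (conj_fs quad).
ilia.
Qed.

Lemma direct_image_stable (m : closed_point i' -> int) :
  finite_supp m -> fsum m = 0 -> fsum half_div = -1 ->
  (forall u, u != 0 -> ~ forall P, m P - m (sg P) = P u) ->
  stable2 (direct_image i fs (order_line m)).
Proof.
move=> fm sm sh nu; have [vb dE] := direct_image_bundle fm.
split=> // M /(line_subbundle_direct_image fm sm)[dM|[u u0 uE]]; last by case: (nu u u0).
(* The slope is -1/2, and an integer lies below -1/2 exactly when it is negative. *)
rewrite dE sh sm subr0 ltr_pdivlMr// -[2 : rat]/(2%:~R) -intrM ltr_int; ilia.
Qed.

End DirectImage.

(** * Functions with two poles on a hyperelliptic curve *)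

Section TwoPoles.
Variables (k : closedFieldType) (K K' : fieldType).
Variables (i : {rmorphism k -> K}) (i' : {rmorphism k -> K'}).
Variable fs : {rmorphism K -> K'}.
Variables (w : K') (d : K).
Hypothesis hfs : forall c, fs (i c) = i' c.
Hypothesis quad : quadratic_extension fs w d.
Hypothesis char2 : 2%:R != 0 :> k.
Hypothesis curve : complete_curve i.
Variable oo : closed_point i.
Hypothesis d_oo : oo d = -6.
Hypothesis d_fin : forall p, p <> oo -> p d <= 1.
Implicit Types (p : closed_point i) (P Q R : closed_point i') (a b : K).

Local Notation sg := (conj_point hfs quad).
Local Notation nm := (norm fs w d).
Local Notation below := (below hfs quad).
Local Notation above := (above hfs quad char2 curve).

(* Writing g = a + b w, the trace and norm bound the poles of b: at most one
   at the images of P and Q, while w has so high a pole at infinity that b must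
   vanish there to order 3; the degree of div b then forces b = 0. *)
Lemma two_poles g P Q : g != 0 -> below P <> oo -> below Q <> oo ->
  below P <> below Q -> (forall R, - ((R == P)%:Z + (R == Q)%:Z) <= R g) ->
  forall R, R g = 0.
Proof.
move=> g0 Poo Qoo PQ gP.
pose a := (coord fs w g).1; pose b := (coord fs w g).2.
have gE : g = fs a + fs b * w by exact: coordE quad g.
pose q1 := below P; pose q2 := below Q.
have PneQ : P <> Q by move=> E; apply: PQ; rewrite E.
have gR1 R : -1 <= R g.
  have := gP R; case: (R =P P) => [->|_]; last by case: (R == Q); ilia.
  by move/eqP/negPf: PneQ => ->; ilia.
have gR0 R : below R <> q1 -> below R <> q2 -> 0 <= R g.
  move=> R1 R2; have := gP R; case: (R =P P) => [E|_]; first by case: R1; rewrite E.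
  by case: (R =P Q) => [E|_]; [case: R2; rewrite E|ilia].
have two : i' 2%:R != 0 by rewrite fmorph_eq0.
have w0 : w != 0.
  have [w2 _ _] := quad; apply/eqP => w0; move: (d_neq0 quad).
  by rewrite -(fmorph_eq0 fs) -w2 w0 expr0n /= eqxx.
have bpart R n : n <= R g -> n <= (sg R) g -> val_ge R n (fs b * w).
  move=> h1 h2; have : val_ge R n (i' 2%:R * (fs b * w)).
    have -> : i' 2%:R * (fs b * w) = g - conj fs w g.
      rewrite /conj -/a -/b {1}gE rmorph_nat; ring.
    by apply: val_geB; right.
  move=> h; have -> : fs b * w = i' 2%:R * (fs b * w) / i' 2%:R.
    by rewrite [i' _ * _]mulrC mulfK.
  by apply: (@val_ge_div _ _ _ _ _ 0) => //; rewrite ?valuation_const// addr0.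
have [b0|b0] := eqVneq b 0; last first.
  have z0 : fs b * w != 0 by rewrite mulf_neq0 ?fmorph_eq0.
  have nmz : nm (fs b * w) = - (b ^+ 2 * d).
    by have := norm_coord quad 0 b; rewrite rmorph0 add0r expr0n sub0r.
  (* The norm of [b w] is [- b^2 d], and its order at [p] is a sum over the fibre of one or two
     terms, each at least [n]. As [n <= 0], the bound [2 n] covers both cases. *)
  have key p n : n <= 0 -> (forall R, below R = p -> n <= R g) ->
      n * 2 <= p b * 2 + p d.
    move=> n0 hn; have E : p b * 2 + p d = p (nm (fs b * w)).
      by rewrite nmz valN valuationM ?expf_neq0 ?(d_neq0 quad)// valX//; ilia.
    rewrite E -(fibre_sum_val hfs quad char2 curve p z0) /fibre_sum.
    have bA : below (above p) = p by apply/(below_above hfs quad char2 curve); left.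
    have h1 : n <= above p (fs b * w).
      by apply: val_geP z0 _; apply: bpart; apply: hn; rewrite ?below_conj.
    have h2 : n <= sg (above p) (fs b * w).
      by apply: val_geP z0 _; apply: bpart; apply: hn; rewrite ?below_conj.
    by case: ifP => _; ilia.
  have [fb sb] := curve.2 _ b0.
  (* [key] gives order at least 3 at [oo], where [d] has order -6. At [q1] and [q2] it gives
     [2 (p b) >= -3], elsewhere [2 (p b) >= -1], so by parity at least -1 and 0. Thus [D] is
     effective of degree -1, a contradiction. *)
  pose D p := p b + (p == q1)%:Z * 1 + (p == q2)%:Z * 1 + (p == oo)%:Z * -3.
  have D0 p : 0 <= D p.
    have h1 := key p (-1) isT (fun R _ => gR1 R).
    have h0 : p <> q1 -> p <> q2 -> 0 <= p b * 2 + p d.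
      by move=> n1 n2; apply: (key p 0) => // R bR; apply: gR0; rewrite bR.
    rewrite /D; case: (p =P oo) => [->|poo].
      have oo1 : (oo == q1) = false by apply/eqP => E; apply: Poo; rewrite E.
      have oo2 : (oo == q2) = false by apply/eqP => E; apply: Qoo; rewrite E.
      rewrite oo1 oo2; have := key oo 0 isT; rewrite d_oo => h.
      have : 0 * 2 <= oo b * 2 - 6.
        by apply: h => R bR; apply: gR0; rewrite bR => E; [apply: Poo|apply: Qoo].
      by ilia.
    have dp := d_fin poo.
    have [E1|n1] := eqVneq p q1; have [E2|n2] := eqVneq p q2.
    - by case: PQ; exact: etrans (esym E1) E2.
    - by ilia.
    - by ilia.
    - by have := h0 (elimN eqP n1) (elimN eqP n2); ilia.
  have : 0 <= fsum D by exact: fsum_ge0.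
  have f1 := finite_supp_pt q1 1; have f2 := finite_supp_pt q2 1.
  have f3 := finite_supp_pt oo (-3).
  rewrite /D fsumD//; last by apply: finite_suppD => //; exact: finite_suppD.
  rewrite fsumD//; last exact: finite_suppD.
  by rewrite fsumD// sb !fsum_pt.
have gE' : g = fs a by rewrite gE b0 rmorph0 mul0r addr0.
have a0 : a != 0 by apply: contra_neq g0 => a0; rewrite gE' a0 rmorph0.
have [fa sa] := curve.2 _ a0.
(* Now [g] comes from [K], so a pole at [S] would recur at the conjugate of [S], which is neither
   [S] nor [S']. At a ramified [S] the order is even and at least -1. *)
have aP p S S' : below S = p -> below S' <> below S ->
    (forall R, - ((R == S)%:Z + (R == S')%:Z) <= R g) -> 0 <= p a.
  move=> bS SS' h; have : - ((S == S)%:Z + (S == S')%:Z) <= S g by exact: h.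
  have : - ((sg S == S)%:Z + (sg S == S')%:Z) <= sg S g by exact: h.
  have -> : (S == S') = false by apply/eqP => E; apply: SS'; rewrite E.
  have -> : (sg S == S') = false.
    by apply/eqP => E; apply: SS'; rewrite -E below_conj.
  rewrite eqxx gE'.
  case: (aboveP hfs quad char2 curve p) => [n pd AA bA afs|n pd AA bA afs].
    by rewrite !(afs S)// => _; ilia.
  have -> : (sg S == S) = false by apply/eqP => E; apply: (bA S bS).
  by rewrite afs ?below_conj//; ilia.
have a_ge0 p : 0 <= p a.
  have [p1|p1] := pselect (below P = p).
    by apply: (aP p P Q) => //; exact: nesym.
  have [p2|p2] := pselect (below Q = p).
    by apply: (aP p Q P) => // R; rewrite addrC; exact: gP.
  have bA : below (above p) = p by apply/(below_above hfs quad char2 curve); left.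
  have := gR0 (above p); rewrite bA gE' => /(_ (nesym p1) (nesym p2)).
  by case: (aboveP hfs quad char2 curve p) => [n pd AA _ afs|n pd AA _ afs];
    rewrite afs//; ilia.
have a_eq0 := fsum_eq0 fa a_ge0 sa.
move=> R; have /maps_toP[e [_ Re]] : maps_to fs R (below R) by apply/(maps_to_below hfs quad).
by rewrite gE' Re a_eq0 mulr0.
Qed.

End TwoPoles.

(** * Orders of linear and quadratic polynomials on the line *)

Section LineValues.
Variables (k : closedFieldType) (K : fieldType) (i : {rmorphism k -> K}) (T : K).
Hypothesis gT : line_generator i T.
Hypothesis char2 : 2%:R != 0 :> k.
Implicit Types (p q : closed_point i) (c e : k).

Lemma val_line_pole p c : p T = -1 -> p (i c - T) = -1.
Proof. by move=> pT; rewrite -opprB valN (line_point_pole gT _).2 pT. Qed.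

Lemma val_line_at p c : 0 < p (T - i c) -> p (i c - T) = 1.
Proof.
have [P [P1 _ Pu]] := line_point c gT.
by move=> /Pu ->; rewrite -opprB valN.
Qed.

Lemma val_line_away p c e : 0 < p (T - i c) -> e != c -> p (i e - T) = 0.
Proof.
move=> pc ec; have iec : i (e - c) != 0 by rewrite fmorph_eq0 subr_eq0.
have -> : i e - T = i (e - c) + (i c - T) by rewrite rmorphB; ring.
rewrite val_addl// valuation_const// ?subr_eq0//.
by right; rewrite val_line_at.
Qed.

Lemma val_line_finite p c : p T = -1 \/ exists2 e, 0 < p (T - i e) & p (i c - T) = (e == c)%:Z.
Proof.
have [P [P1 _ Pu]] := line_point_infty gT.
case: (line_point_cases p gT) => [/Pu ->|[e pe]]; first by left.
right; exists e => //; case: eqP => [E|/eqP ec].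
  by rewrite val_line_at// -E.
by rewrite (val_line_away pe)// eq_sym.
Qed.

Lemma val_sqr_pole p e : p T = -1 -> p (i e - T ^+ 2) = -2.
Proof.
move=> pT; have T0 := line_generator_neq0 gT.
rewrite -opprB valN val_addl ?expf_neq0 ?valX// ?pT//.
by apply/val_geN; apply: val_ge_le (val_ge_const _ _).
Qed.

Lemma val_sqr_at p c : 0 < p (T - i c) -> c != 0 -> p (i (c ^+ 2) - T ^+ 2) = 1.
Proof.
move=> pc c0; have h1 := val_line_at pc.
have h2 : p (i (- c) - T) = 0.
  apply: (val_line_away pc); rewrite -subr_eq0 -opprD oppr_eq0 -mulr2n.
  by rewrite -mulr_natl mulf_neq0.
have n1 : i c - T != 0 by rewrite -opprB oppr_eq0 line_generator_sub_neq0.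
have n2 : i (- c) - T != 0 by rewrite -opprB oppr_eq0 line_generator_sub_neq0.
have -> : i (c ^+ 2) - T ^+ 2 = - ((i c - T) * (i (- c) - T)).
  by rewrite rmorphXn rmorphN; ring.
by rewrite valN valuationM// h1 h2.
Qed.

Lemma val_sqr_away p c e : 0 < p (T - i c) -> e != c ^+ 2 -> p (i e - T ^+ 2) = 0.
Proof.
move=> pc ec; have iec : i (e - c ^+ 2) != 0 by rewrite fmorph_eq0 subr_eq0.
have -> : i e - T ^+ 2 = i (e - c ^+ 2) + (i c - T) * (i c + T).
  by rewrite rmorphB rmorphXn; ring.
rewrite val_addl// valuation_const// ?subr_eq0//.
apply: (@val_geM _ _ _ _ 1 0); first by right; rewrite val_line_at.
apply: val_geD (val_ge_const _ _) _; rewrite -[T](subrK (i c)).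
by apply: val_geD (val_ge_const _ _); right; exact: ltW.
Qed.

End LineValues.

(** * The curves E and C *)

Section EllipticPoints.
Variables (k : closedFieldType) (KE : fieldType) (iE : {rmorphism k -> KE}).
Variables (t t' : k) (x y : KE) (phi : {rmorphism {fraction {poly k}} -> KE}).
Hypothesis char2 : 2%:R != 0 :> k.
Hypotheses (ht'0 : t' != 0) (ht'1 : t' != 1) (htt' : t != t').
Hypothesis phi_const : forall c, phi (rat_const k c) = iE c.
Hypothesis phi_X : phi (rat_X k) = x.
Hypothesis quad : quadratic_extension phi y
  (FracField.tofrac ('X * ('X - 1) * ('X - t%:P))).

(* The double cover x : E -> P^1 is ramified at infinity and not above t'. *)
Lemma elliptic_points : exists poo : closed_point iE,
  [/\ poo (iE t' - x) = -2,
      forall p : closed_point iE, p <> poo -> p (iE t' - x) = 0 \/ p (iE t' - x) = 1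
    & exists p : closed_point iE, p (iE t' - x) = 1].
Proof.
have curve := rational_functions_complete k.
have gT := rat_X_generator k.
have [oo [ooT _ oo_u]] := line_point_infty gT.
have fE : FracField.tofrac ('X * ('X - 1) * ('X - t%:P)) =
    (rat_const k 0 - rat_X k) * (rat_const k 1 - rat_X k) * (rat_const k t - rat_X k) * -1.
  by rewrite !rmorphM !rmorphB rmorph0 !rmorph1 /rat_X /=; ring.
have nz (c : k) : rat_const k c - rat_X k != 0.
  by rewrite -opprB oppr_eq0 line_generator_sub_neq0.
have valf (q : closed_point (rat_const k)) : q (FracField.tofrac ('X * ('X - 1) * ('X - t%:P))) =
    q (rat_const k 0 - rat_X k) + q (rat_const k 1 - rat_X k) + q (rat_const k t - rat_X k).
  by rewrite fE !valuationM ?mulf_neq0 ?oppr_eq0 ?oner_eq0// valN1 addr0.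
have dE : iE t' - x = phi (rat_const k t' - rat_X k) by rewrite rmorphB phi_const phi_X.
pose bel := below phi_const quad; pose abv := above phi_const quad char2 curve.
have bel_abv q : bel (abv q) = q.
  by apply/(below_above phi_const quad char2 curve); left.
have f_oo : oo (FracField.tofrac ('X * ('X - 1) * ('X - t%:P))) = -3.
  by rewrite valf !(val_line_pole gT _ ooT).
(* [t'] avoids the finite branch points 0, 1 and [t], so the cover splits there and the simple zero
   stays simple. *)
have above_t' (p : closed_point iE) : 0 < bel p (rat_X k - rat_const k t') -> p (iE t' - x) = 1.
  move=> pt; have f0 : bel p (FracField.tofrac ('X * ('X - 1) * ('X - t%:P))) = 0.
    by rewrite valf !(val_line_away gT pt)// eq_sym.
  have d1 := val_line_at gT pt.
  rewrite dE; case: (aboveP phi_const quad char2 curve (bel p)) => [m|m _ _ _ ->//].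
  by rewrite f0; ilia.
exists (abv oo); split.
(* The cubic has odd order -3 at infinity, so the cover ramifies there and doubles the simple pole
   of [t' - x]. *)
- rewrite dE; case: (aboveP phi_const quad char2 curve oo) => [m _ _ _ ->//|m].
    by rewrite (val_line_pole gT _ ooT).
  by rewrite f_oo; ilia.
- move=> p ppoo; have poo : bel p <> oo.
    move=> E; apply: ppoo; move: E.
    case: (aboveP phi_const quad char2 curve oo) => [m _ _ h _|m]; first exact: h.
    by rewrite f_oo; ilia.
  case: (val_line_finite gT (bel p) t') => [h|[e pe]].
    by case: poo; apply: oo_u; rewrite h.
  have [et|et] := eqVneq e t'; first by move=> _; right; apply: above_t'; rewrite -et.
  move=> d0; left; rewrite dE.
  have /maps_toP[n [_ ->]] : maps_to phi p (bel p) by apply/(maps_to_below phi_const quad).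
  by rewrite d0 mulr0.
have [q [q1 _ _]] := line_point t' gT.
by exists (abv q); apply: above_t'; rewrite bel_abv q1.
Qed.

End EllipticPoints.

Section GenusTwoPoints.
Variables (k : closedFieldType) (t t' : k).
Hypothesis char2 : 2%:R != 0 :> k.
Hypotheses (ht0 : t != 0) (ht1 : t != 1) (ht'0 : t' != 0) (ht'1 : t' != 1) (htt' : t != t').

Definition sextic : {poly k} :=
  (t'%:P - 'X^2) * ((t' - 1)%:P - 'X^2) * ((t' - t)%:P - 'X^2).

(** The roots are simple: [t'], [t' - 1] and [t' - t] are nonzero and pairwise distinct, and each
    has two distinct opposite square roots. These are the bounds that [two_poles] asks for. *)
Lemma sextic_valuation (p : closed_point (rat_const k)) :
  (p (rat_X k) = -1 -> p (FracField.tofrac sextic) = -6) /\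
  (p (rat_X k) <> -1 -> p (FracField.tofrac sextic) <= 1).
Proof.
have gT := rat_X_generator k.
have sE : FracField.tofrac sextic = (rat_const k t' - rat_X k ^+ 2) *
    (rat_const k (t' - 1) - rat_X k ^+ 2) * (rat_const k (t' - t) - rat_X k ^+ 2).
  by rewrite /sextic !tofracM !(tofracB, tofracXn).
have nz (e : k) : rat_const k e - rat_X k ^+ 2 != 0.
  have := evp_neq0 gT (_ : e%:P - 'X^2 != 0).
  rewrite evpD evpC evpN evpXn; apply.
  by rewrite -oppr_eq0 opprB -size_poly_eq0 size_XnsubC.
have -> : p (FracField.tofrac sextic) = p (rat_const k t' - rat_X k ^+ 2) +
    p (rat_const k (t' - 1) - rat_X k ^+ 2) + p (rat_const k (t' - t) - rat_X k ^+ 2).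
  by rewrite sE !valuationM ?mulf_neq0.
split=> pT; first by rewrite !(val_sqr_pole gT _ pT).
case: (val_line_finite gT p 0) => // -[c pc _].
have v e : e != 0 -> p (rat_const k e - rat_X k ^+ 2) = (e == c ^+ 2)%:Z.
  move=> e0; case: eqP => [E|/eqP ec]; last by rewrite (val_sqr_away gT pc).
  rewrite E (val_sqr_at gT char2 pc)//.
  by apply: contra_neq e0 => c0; rewrite E c0 expr0n.
rewrite !v ?subr_eq0//; last by rewrite eq_sym.
have n1 : (t' == c ^+ 2) && (t' - 1 == c ^+ 2) = false.
  apply/negP => /andP[/eqP <-]; rewrite -subr_eq0 addrAC subrr add0r oppr_eq0.
  by rewrite oner_eq0.
have n2 : (t' == c ^+ 2) && (t' - t == c ^+ 2) = false.
  apply/negP => /andP[/eqP <-]; rewrite -subr_eq0 addrAC subrr add0r oppr_eq0.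
  by apply/negP.
have n3 : (t' - 1 == c ^+ 2) && (t' - t == c ^+ 2) = false.
  apply/negP => /andP[/eqP <-]; rewrite (inj_eq (addrI _)) (inj_eq oppr_inj).
  by apply/negP.
by move: n1 n2 n3; case: (t' == _); case: (t' - 1 == _); case: (t' - t == _).
Qed.

End GenusTwoPoints.

Lemma pair_points (T : eqType) (a b a' b' : T) : a' <> b' ->
  (forall r : T, (r == a)%:Z + (r == b)%:Z = (r == a')%:Z + (r == b')%:Z) ->
  a = a' /\ b = b' \/ a = b' /\ b = a'.
Proof.
move=> /eqP/negPf ab' h; have := h a'; have := h b'; rewrite !eqxx ab'.
rewrite [b' == a']eq_sym ab' addr0 add0r.
case: (b' =P a) => [<-|_]; case: (b' =P b) => [<-|_] //.
- by rewrite ab' addr0; case: (a' =P b) => // <- _ _; right.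
- by rewrite ab' addr0; case: (a' =P a) => // <- _ _; left.
Qed.

Section LineClasses.
Variables (k K : fieldType) (i : {rmorphism k -> K}).
Implicit Types (m : closed_point i -> int) (L : line_sheaf i).

Lemma isomorphic_lines_refl L : isomorphic_lines L L.
Proof.
exists 1; first exact: oner_neq0.
move=> P; apply/seteqP; split=> [s Ls|_ [s Ls <-]]; last by rewrite mul1r.
by exists s; rewrite ?mul1r.
Qed.

Lemma pic_class_isomorphic L L' : pic_class L = pic_class L' -> isomorphic_lines L L'.
Proof.
move=> LL'; have : pic_class L' L' by exact: isomorphic_lines_refl.
by rewrite -LL'.
Qed.

Lemma isomorphic_order_lines m m' : isomorphic_lines (order_line m) (order_line m') ->
  exists2 h : K, h != 0 & forall P, m' P = P h + m P.
Proof.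
move=> [h h0 hE]; exists h => // P; apply/eqP; rewrite eq_le; apply/andP; split.
  have [u u0 Pu] := valuation_unif P.
  have : order_line m' P (h * u ^ m P).
    rewrite hE; exists (u ^ m P) => //=.
    by right; rewrite valXz// Pu mulr1.
  move/val_geP; rewrite mulf_neq0 ?expfz_neq0// => /(_ isT).
  by rewrite valuationM ?expfz_neq0// valXz// Pu mulr1.
apply: (@val_ge_inj _ _ _ P) => v /= vm'; have : order_line m' P v by [].
rewrite hE => -[s sm <-]; exact: val_geM (val_ge_refl _ _) sm.
Qed.

End LineClasses.

(** * General pairs of points and stability *)

Section Generic.
Variables (k : closedFieldType) (t t' : k).
Hypothesis char2 : 2%:R != 0 :> k.
Hypotheses (ht0 : t != 0) (ht1 : t != 1) (ht'0 : t' != 0) (ht'1 : t' != 1) (htt' : t != t').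
Variables (KE KC : fieldType).
Variables (iE : {rmorphism k -> KE}) (iC : {rmorphism k -> KC}).
Variables (x y : KE) (xi eta : KC).
Hypothesis hE : function_field_of iE ('X^2 - ('X * ('X - 1) * ('X - t%:P))%:P) x y.
Hypothesis hC : function_field_of iC
  ('X^2 - ((t'%:P - 'X^2) * ((t' - 1)%:P - 'X^2) * ((t' - t)%:P - 'X^2))%:P) xi eta.
Variable fs : {rmorphism KE -> KC}.
Hypothesis hfs : forall c : k, fs (iE c) = iC c.
Hypothesis hfx : fs x = iC t' - xi ^+ 2.
Hypothesis hfy : fs y = eta.
Implicit Types P Q R : closed_point iC.

Local Notation d := (iE t' - x).

Lemma elliptic_tower : complete_curve iE /\ exists poo : closed_point iE,
  [/\ poo d = -2, forall p : closed_point iE, p <> poo -> p d = 0 \/ p d = 1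
    & exists p : closed_point iE, p d = 1].
Proof.
have [phi [phic phiX quad]] := quadratic_function_field hE.
split; first exact: cover_complete phic quad char2 (rational_functions_complete k).
exact: elliptic_points char2 ht'0 ht'1 htt' phic phiX quad.
Qed.

(** [t' - x] has a simple zero on [E], hence is not a square in [KE]. Together with [eta], which
    comes from [KE], its square root [xi] generates [KC]. *)
Lemma cover_quadratic : quadratic_extension fs xi d.
Proof.
have [_ [_ [_ _ [p pd]]]] := elliptic_tower.
have xi2 : xi ^+ 2 = fs d by rewrite rmorphB hfs hfx subKr.
have d0 : d != 0 by apply/eqP => d0; move: pd; rewrite d0 valuation0.
have free a b : fs a + fs b * xi = 0 -> a = 0 /\ b = 0.
  have [-> |b0] := eqVneq b 0.
    by rewrite rmorph0 mul0r addr0 => /eqP; rewrite fmorph_eq0 => /eqP.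
  move=> E; have aE : fs a = - (fs b * xi) by apply/eqP; rewrite -addr_eq0 E.
  have sq : a ^+ 2 = b ^+ 2 * d.
    by apply: (fmorph_inj fs); rewrite rmorphXn aE sqrrN exprMn xi2 rmorphM rmorphXn.
  have a0 : a != 0.
    apply/eqP => a0; move/eqP: sq.
    by rewrite a0 expr0n eq_sym mulf_eq0 expf_eq0 (negPf b0) (negPf d0).
  by have := congr1 p sq; rewrite valuationM ?expf_neq0// !valX// pd; ilia.
split=> //; apply: (function_field_ind hC).
- by move=> c; rewrite -hfs; exact: quadratic_span_fs.
- exact: quadratic_span_w.
- by rewrite -hfy; exact: quadratic_span_fs.
- exact: quadratic_spanD.
- exact: (quadratic_spanM xi2).
- exact: (quadratic_spanV xi2 free).
Qed.

Let curveE : complete_curve iE := elliptic_tower.1.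
Let curveC : complete_curve iC := cover_complete hfs cover_quadratic char2 curveE.

Local Notation sg := (conj_point hfs cover_quadratic).

(* The point at infinity of E, where x : E -> P^1 is ramified. *)
Definition ramified_pole : closed_point iE := projT1 (cid elliptic_tower.2).

Lemma ramified_poleP : ramified_pole d = -2 /\
  forall p : closed_point iE, p <> ramified_pole -> p d = 0 \/ p d = 1.
Proof. by rewrite /ramified_pole; case: (cid _) => p [/= ? ? _]. Qed.

(** The double pole contributes -1, while a simple zero contributes 0, half of 1 rounded down. *)
Lemma fsum_half_div : fsum (half_div d : closed_point iE -> int) = -1.
Proof.
have [poo pd] := ramified_poleP.
rewrite (_ : half_div d = fun p => (p == ramified_pole)%:Z * -1); first exact: fsum_pt.
apply/funext => p; rewrite /half_div; case: eqP => [->|/pd[]->] //.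
by rewrite poo.
Qed.

Local Notation D0 := (@polar_divisor _ _ iC xi).

Lemma polar_divisor_conj R : D0 (sg R) = D0 R.
Proof. by rewrite /polar_divisor conj_pointE (conj_w cover_quadratic) valN. Qed.

(** The order of [t' - x] at its pole is even, so [C] splits there and [xi] has a simple pole at
    each of two points. *)
Lemma fibre_sum_polar_divisor :
  fibre_sum hfs cover_quadratic char2 curveE D0 = fun p => (p == ramified_pole)%:Z * 2.
Proof.
have [poo pd] := ramified_poleP; apply/funext => p.
have [xi2 _ _] := cover_quadratic.
have xi0 : xi != 0.
  apply/eqP => xi0; move: (d_neq0 cover_quadratic).
  by rewrite -(fmorph_eq0 fs) -xi2 xi0 expr0n /= eqxx.
have bA : below hfs cover_quadratic (above hfs cover_quadratic char2 curveE p) = p.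
  by apply/(below_above hfs cover_quadratic char2 curveE); left.
rewrite /fibre_sum polar_divisor_conj /polar_divisor.
set A := above _ _ _ _ _ in bA *.
have Axi : A (fs d) = 2 * A xi by rewrite -xi2 valX.
case: (p =P ramified_pole) => [pE|/pd dp].
  case: (aboveP hfs cover_quadratic char2 curveE p) => [m dm|m dm _ _ /(_ A d bA) Ad].
    by move: dm; rewrite pE poo; ilia.
  have Axi1 : A xi = -1 by move: Ad; rewrite Axi pE poo; ilia.
  by rewrite Axi1.
have Axi0 : 0 <= A xi.
  have : val_ge A 0 (fs d).
    have Ap : maps_to fs A p by apply/(maps_to_below hfs cover_quadratic).
    by apply: (maps_to_val_ge Ap) => //; right; case: dp => ->.
  move/val_geP; rewrite -xi2 expf_neq0// valX// => /(_ isT); ilia.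
have -> : Num.max 0 (- A xi) = 0 by rewrite max_l// oppr_le0.
by rewrite mul0r; case: ifP.
Qed.

Lemma polar_divisor_finite : finite_supp D0 /\ fsum D0 = 2.
Proof.
have xi0 : xi != 0.
  have [xi2 _ _] := cover_quadratic; apply/eqP => xi0.
  by move: (d_neq0 cover_quadratic); rewrite -(fmorph_eq0 fs) -xi2 xi0 expr0n /= eqxx.
have fD : finite_supp D0.
  apply: finite_supp_sub (curveC.2 _ xi0).1 => P Pxi.
  by rewrite /polar_divisor Pxi oppr0 maxxx.
split=> //; rewrite (fsum_fibre_sum hfs cover_quadratic char2 curveE fD).2.
by rewrite fibre_sum_polar_divisor fsum_pt.
Qed.

Definition two_point_order (PQ : closed_point iC * closed_point iC) R : int :=
  D0 R - ((R == PQ.1)%:Z + (R == PQ.2)%:Z).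

Lemma line_two_points PQ : line_of_divisor (fun R =>
    point_divisor PQ.1 R + point_divisor PQ.2 R - D0 R) = order_line (two_point_order PQ).
Proof.
apply/funext => R; rewrite /line_of_divisor /order_line /two_point_order /point_divisor.
by rewrite opprB.
Qed.

Lemma two_point_order_finite PQ :
  finite_supp (two_point_order PQ) /\ fsum (two_point_order PQ) = 0.
Proof.
have [fD sD] := polar_divisor_finite.
have E : two_point_order PQ = fun R => D0 R + ((R == PQ.1)%:Z * -1 + (R == PQ.2)%:Z * -1).
  by apply/funext => R; rewrite /two_point_order; ilia.
have f1 := finite_supp_pt PQ.1 (-1); have f2 := finite_supp_pt PQ.2 (-1).
rewrite E; split; first by apply: finite_suppD => //; exact: finite_suppD.
rewrite fsumD//; last exact: finite_suppD.
by rewrite fsumD// !fsum_pt sD.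
Qed.

(** Both values of [xi] are finite. That [a] differs from [b] keeps the pair from being a fibre of
    [xi]; that it differs from [- b] keeps [sg] from exchanging the points; and [sg] cannot fix
    both, since then [a = b = 0]. *)
Definition general_pair (PQ : closed_point iC * closed_point iC) : Prop :=
  exists a b, [/\ has_val PQ.1 xi a, has_val PQ.2 xi b & a ^+ 2 != b ^+ 2].

(** Here [KC] is taken over [k(xi)]: distinct finite values of [xi] are distinct points of the line
    below, away from infinity, which is the situation of [two_poles]. *)
Lemma general_pair_poles PQ g : general_pair PQ -> g != 0 ->
  (forall R, - ((R == PQ.1)%:Z + (R == PQ.2)%:Z) <= R g) -> forall R, R g = 0.
Proof.
have [psi [psic psiX quad]] := quadratic_function_field hC.
have gT := rat_X_generator k.
have [oo [ooT _ oo_u]] := line_point_infty gT.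
move=> [a [b [Pa Qb ab]]] g0.
have vanish P c : has_val P xi c -> 0 < below psic quad P (rat_X k - rat_const k c).
  move=> Pc; have /maps_toP[e [e0 Pe]] : maps_to psi P (below psic quad P).
    by apply/(maps_to_below psic quad).
  have Tc : rat_X k - rat_const k c != 0 by exact: line_generator_sub_neq0.
  have : val_ge P 1 (psi (rat_X k - rat_const k c)) by rewrite rmorphB psiX psic.
  by move/val_geP; rewrite fmorph_eq0 => /(_ Tc); rewrite Pe -(pmulr_rgt0 _ e0).
have finite P c : has_val P xi c -> below psic quad P <> oo.
  move=> /vanish + E; rewrite E (line_point_pole gT _).2 ooT//.
have d_oo := (sextic_valuation char2 ht0 ht1 ht'0 ht'1 htt' oo).1 ooT.
have d_fin p : p <> oo -> p (FracField.tofrac (sextic t t')) <= 1.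
  move=> poo; apply: (sextic_valuation char2 ht0 ht1 ht'0 ht'1 htt' p).2 => pT.
  by apply: poo; apply: oo_u; rewrite pT.
apply: (two_poles (quad := quad) char2 (rational_functions_complete k) d_oo d_fin g0).
- exact: finite Pa.
- exact: finite Qb.
move=> E; have := vanish _ _ Qb; rewrite -E => h.
have ba : b != a by apply: contra_neq ab => ->.
have := val_line_away gT (vanish _ _ Pa) ba; have := val_line_at gT h; ilia.
Qed.

Lemma general_pair_neq PQ : general_pair PQ -> PQ.1 <> PQ.2.
Proof.
move=> [a [b [Pa Qb ab]]] E; move: Pa ab; rewrite E => /has_val_inj/(_ Qb) ->.
by rewrite eqxx.
Qed.

Lemma general_pair_sym P Q : general_pair (P, Q) -> general_pair (Q, P).
Proof. by move=> [a [b [Pa Qb ab]]]; exists b, a; rewrite eq_sym. Qed.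

(** The function is [xi^2 (x) 1 - 1 (x) xi^2]; regularity of [xi^2] is what makes [xi] finite at
    both points. *)
Lemma general_pair_basic_open : exists (n : nat) (a b : 'I_n -> KC),
  basic_open2 a b = general_pair.
Proof.
pose a (j : 'I_2) := if j == ord0 then xi ^+ 2 else 1.
pose b (j : 'I_2) := if j == ord0 then 1 else - xi ^+ 2.
exists 2%N, a, b; apply/seteqP.
have one (P : closed_point iC) : has_val P 1 1 by rewrite -(rmorph1 iC); exact: has_val_const.
split=> [[P Q]|[P Q] [v [v' [/= Pv Qv' vv']]]].
  rewrite /basic_open2 /= !big_ord_recl big_ord0 addr0 /a /b /=.
  rewrite (valueE (one P)) (valueE (one Q)) mulr1 mul1r => -[reg nz].
  have sqr (R : closed_point iC) : regular_at R (xi ^+ 2) -> exists v, has_val R xi v.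
    move=> h; apply: (curveC.1 R); have [->|xi0] := eqVneq xi 0; first by left.
    have xi20 : xi ^+ 2 != 0 by rewrite expf_neq0.
    by move: (val_geP xi20 h); rewrite valX// => h'; right; move: h'; ilia.
  have [v Pv] : exists v, has_val P xi v by apply: sqr; case: (reg ord0).
  have [v' Qv'] : exists v, has_val Q xi v.
    apply: sqr; case: (reg (lift ord0 ord0)) => _ /= h.
    by rewrite -[xi ^+ 2]opprK; exact: val_geN.
  exists v, v'; split=> //; move: nz.
  rewrite (valueE (has_valM Pv Pv : has_val P (xi ^+ 2) _)).
  by rewrite (valueE (has_valN (has_valM Qv' Qv') : has_val Q (- xi ^+ 2) _)) subr_eq0 !expr2.
have Pv2 : has_val P (xi ^+ 2) (v ^+ 2) by rewrite !expr2; exact: has_valM.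
have Qv2 : has_val Q (- xi ^+ 2) (- v' ^+ 2) by rewrite !expr2; apply: has_valN; exact: has_valM.
split.
  move=> j; rewrite /a /b /=.
  by case: ifP => _; split; apply: has_val_regular; try exact: one; eassumption.
rewrite /= !big_ord_recl big_ord0 addr0 /a /b /=.
by rewrite !(valueE (one _)) (valueE Pv2) (valueE Qv2) mulr1 mul1r subr_eq0.
Qed.

Lemma general_pair_exists : exists PQ, general_pair PQ.
Proof.
have [psi [psic psiX quad]] := quadratic_function_field hC.
have gT := rat_X_generator k.
have pt (c : k) : exists P : closed_point iC, has_val P xi c.
  have [q [q1 _ _]] := line_point c gT.
  pose P := above psic quad char2 (rational_functions_complete k) q.
  have Pq : maps_to psi P q.
    apply/(maps_to_below psic quad).
    by apply/(below_above psic quad char2 (rational_functions_complete k)); left.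
  exists P; rewrite /has_val -psiX -psic -rmorphB.
  by apply/val_ge_vanishes; apply: (maps_to_val_ge Pq) => //; right; rewrite q1.
have [P P0] := pt 0; have [Q Q1] := pt 1.
by exists (P, Q), 0, 1; rewrite expr0n expr1n eq_sym oner_eq0.
Qed.

(** [h^-1] has divisor [P' + Q' - P - Q], so its poles are bounded by a general pair and all its
    orders are 0: the class determines the unordered pair. *)
Lemma general_pair_linear_equivalence PQ PQ' h : general_pair PQ -> h != 0 ->
  (forall R, two_point_order PQ' R = R h + two_point_order PQ R) -> general_pair PQ'.
Proof.
move=> gPQ h0 eqh; have hV0 : h^-1 != 0 by rewrite invr_eq0.
have hVE R : R h^-1 = (R == PQ'.1)%:Z + (R == PQ'.2)%:Z - ((R == PQ.1)%:Z + (R == PQ.2)%:Z).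
  by rewrite valV; have := eqh R; rewrite /two_point_order; ilia.
have R0 : forall R, R h^-1 = 0.
  by apply: (general_pair_poles gPQ hV0) => R; rewrite hVE; ilia.
case: (pair_points (general_pair_neq gPQ) (a := PQ'.1) (b := PQ'.2)) => [R|[E1 E2]|[E1 E2]].
- by have := hVE R; rewrite R0; ilia.
- by case: (PQ') (PQ) E1 E2 gPQ => [P' Q'] [P Q] /= -> ->.
- by case: (PQ') (PQ) E1 E2 gPQ => [P' Q'] [P Q] /= -> ->; exact: general_pair_sym.
Qed.

Lemma general_pair_stable PQ (m : closed_point iC -> int) h : general_pair PQ -> h != 0 ->
  finite_supp m -> fsum m = 0 -> (forall R, m R = R h + two_point_order PQ R) ->
  stable2 (direct_image iE fs (order_line m)).
Proof.
move=> gPQ h0 fm sm mE.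
apply: (direct_image_stable (quad := cover_quadratic) (hfs := hfs) char2 curveE fm sm
  fsum_half_div) => u u0 uE.
have ch0 : conj fs xi h != 0 by rewrite (conj_eq0 cover_quadratic).
(* [h] accounts for the choice of [L] in its class. Without its contribution, and since the polar
   divisor is invariant under [sg], there remains the divisor [sg P + sg Q - P - Q]. *)
pose g := u * (conj fs xi h / h).
have g0 : g != 0 by rewrite !mulf_neq0// invr_eq0.
have sg_eq R P : (sg R == P) = (R == sg P).
  by apply/eqP/eqP => [<-|->]; rewrite conj_pointK.
have gE R : R g = (R == sg PQ.1)%:Z + (R == sg PQ.2)%:Z - ((R == PQ.1)%:Z + (R == PQ.2)%:Z).
  rewrite valuationM ?mulf_neq0 ?invr_eq0// val_div//.
  have := uE R; rewrite !mE /two_point_order polar_divisor_conj !sg_eq conj_pointE; ilia.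
have R0 : forall R, R g = 0.
  by apply: (general_pair_poles gPQ g0) => R; rewrite gE; ilia.
have [a [b [Pa Qb /eqP]]] := gPQ; apply.
have sga P c : has_val P xi c -> has_val (sg P) xi (- c).
  move=> Pc; apply: conj_point_has_val; rewrite (conj_w cover_quadratic); exact: has_valN.
have sgP := sga _ _ Pa; have sgQ := sga _ _ Qb.
case: (pair_points (general_pair_neq gPQ) (a := sg PQ.1) (b := sg PQ.2)) => [R|[E1 E2]|[E1 E2]].
- by have := gE R; rewrite R0; ilia.
(* If [sg] fixes both points, then [xi] equals its own opposite there, so both values are 0. *)
- have half (c : k) : - c = c -> c = 0.
    move=> cc; have /eqP : 2%:R * c = 0 by rewrite mulr_natl mulr2n -{1}cc addNr.
    by rewrite mulf_eq0 (negPf char2) => /eqP.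
  rewrite E1 in sgP; rewrite E2 in sgQ.
  by rewrite (half _ (has_val_inj sgP Pa)) (half _ (has_val_inj sgQ Qb)).
by rewrite E1 in sgP; rewrite -(has_val_inj sgP Qb) sqrrN.
Qed.

Lemma generic_stability : exists U : set (set (line_sheaf iC)),
    [/\ pic0_open_genus2 (polar_divisor xi) U,
        U !=set0
      & forall L : line_sheaf iC,
          vector_bundle 1 L -> degree 1 L = 0 -> U (pic_class L) ->
          stable2 (direct_image iE fs L)].
Proof.
pose U := [set c | exists2 PQ, general_pair PQ &
  c = pic_class (order_line (two_point_order PQ))].
exists U; split.
- split=> [_ [PQ gPQ ->]|PQ].
    have [fm sm] := two_point_order_finite PQ.
    have [vb deg] := order_line_bundle curveC fm.
    by exists (order_line (two_point_order PQ)) => //; rewrite /= deg sm oppr0.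
  move=> /= [PQ' gPQ']; rewrite line_two_points => /esym/pic_class_isomorphic.
  move=> /isomorphic_order_lines[h h0 eqh].
  (* Membership in [U] only provides some general pair in the class; saturation makes the given pair
     general as well. *)
  have gPQ := general_pair_linear_equivalence gPQ' h0 eqh.
  have [n [a [b abE]]] := general_pair_basic_open.
  exists n, a, b; rewrite abE; split=> // PQ2 gPQ2 /=.
  by exists PQ2 => //; rewrite line_two_points.
- have [PQ gPQ] := general_pair_exists.
  by exists (pic_class (order_line (two_point_order PQ))), PQ.
move=> L vb deg [PQ gPQ]; have [m [fm sm ->]] := line_bundle_order curveC vb.
move=> /esym/pic_class_isomorphic/isomorphic_order_lines[h h0 eqh].
by apply: general_pair_stable gPQ h0 fm _ eqh; rewrite sm deg oppr0.
Qed.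

End Generic.

Theorem proposition12 (R : realType) (t t' : R[i])
  (ht0 : t != 0) (ht1 : t != 1) (ht'0 : t' != 0) (ht'1 : t' != 1)
  (htt' : t != t')
  (KE KC : fieldType)
  (iE : {rmorphism R[i] -> KE}) (iC : {rmorphism R[i] -> KC})
  (x y : KE) (xi eta : KC)
  (hE : function_field_of iE
          ('X^2 - ('X * ('X - 1) * ('X - t%:P))%:P) x y)
  (hC : function_field_of iC
          ('X^2 - ((t'%:P - 'X^2) * ((t' - 1)%:P - 'X^2)
                     * ((t' - t)%:P - 'X^2))%:P) xi eta)
  (fs : {rmorphism KE -> KC})
  (hfs : forall c : R[i], fs (iE c) = iC c)
  (hfx : fs x = iC t' - xi ^+ 2) (hfy : fs y = eta) :
  exists U : set (set (line_sheaf iC)),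
    [/\ pic0_open_genus2 (polar_divisor xi) U,
        U !=set0
      & forall L : line_sheaf iC,
          vector_bundle 1 L -> degree 1 L = 0 -> U (pic_class L) ->
          stable2 (direct_image iE fs L)].
Proof.
have char2 : 2%:R != 0 :> R[i] by rewrite pnatr_eq0.
exact: (@generic_stability R[i] t t' char2 ht0 ht1 ht'0 ht'1 htt' KE KC iE iC x y
  xi eta hE hC fs hfs hfx hfy).
Qed.
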